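(* Let $d=1$, $n\in\mathbb{N}$, and let $\mu\in\mathcal{M}_{\mathbb{R}}$ be absolutely continuous with respect to the Lebesgue measure on $\mathbb{T}$. Then $\mu$ admits a unique best approximation by a trigonometric polynomial of degree $n$ with respect to the Wasserstein-1 distance; i.e. there is exactly one real-valued trigonometric polynomial $p^*$ of degree at most $n$ such that $W_1(p^*,\mu)\le W_1(p,\mu)$ for all real-valued trigonometric polynomials $p$ of degree at most $n$.
   Context: $\mathbb{N}=\{1,2,\dots\}$, $\mathbb{T}=[0,1)$ is the one-dimensional torus with wrap-around distance $|x-y|_1=\min_{k\in\mathbb{Z}}|x-y+k|$. $\mathcal{M}_{\mathbb{R}}$ is the set of real signed Borel measures $\mu$ on $\mathbb{T}$ of finite total variation with $\mu(\mathbb{T})=1$. A trigonometric polynomial of degree at most $n$ is a function $p(x)=\sum_{k=-n}^n c_ke^{2\pi i kx}$. For $f:\mathbb{T}\to\mathbb{R}$, $\operatorname{Lip}(f)\le1$ means $|f(x)-f(y)|\le|x-y|_1$ for all $x,y$. $W_1(\nu,\mu)=\sup_{\operatorname{Lip}(f)\le1}\left|\int_{\mathbb{T}}f\,\mathrm{d}(\nu-\mu)\right|$, and $W_1(p,\mu)$ means $W_1(\nu,\mu)$ with $\mathrm{d}\nu(x)=p(x)\,\mathrm{d}x$ (it is $+\infty$ if $\int_{\mathbb{T}}p(x)\,\mathrm{d}x\neq1$). *)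

(* Defs.v *)
From mathcomp Require Import all_boot all_order all_algebra complex.
From mathcomp Require Import all_classical all_reals all_analysis.

Set Implicit Arguments.
Unset Strict Implicit.
Unset Printing Implicit Defensive.

Import Order.TTheory GRing.Theory Num.Theory.
Import numFieldNormedType.Exports.

Local Open Scope classical_set_scope.
Local Open Scope complex_scope.
Local Open Scope ring_scope.

(* The torus [0, 1) is a subset of [R]: a signed Borel measure on it is a
   charge on [R] that vanishes on the Borel sets disjoint from it, and only
   the values on [torus] of a function matter.  Charges are finite-valued, so
   that their total variation is finite. *)
Definition torus (R : realType) : set R := `[0, 1[.
Arguments torus : clear implicits.

(* The infimum is attained. *)
Definition tdist (R : realType) (x y : R) : R :=
  inf (range (fun k : int => `|x - y + k%:~R|)).

Definition lip1 (R : realType) (f : R -> R) :=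
  forall x y, torus R x -> torus R y -> `|f x - f y| <= tdist x y.

Section charges.
Context (R : realType).
Local Open Scope ereal_scope.
Implicit Types (mu nu : {charge set (measurableTypeR R) -> \bar R}).

Definition carried_by_torus mu :=
  forall A : set (measurableTypeR R), measurable A -> A `&` torus R = set0 -> mu A = 0.

Definition unit_mass_torus_charge mu :=
  carried_by_torus mu /\ mu (torus R) = 1.

Lemma hahn_exists mu :
  exists PN : set (measurableTypeR R) * set (measurableTypeR R),
    hahn_decomposition mu PN.1 PN.2.
Proof. by have [P [N h]] := Hahn_decomposition mu; exists (P, N). Qed.

(* [jordan_pos] and [jordan_neg] do not depend, on measurable sets, on the
   chosen Hahn decomposition. *)
Definition charge_integral mu (f : R -> R) : \bar R :=
  let h := svalP (cid (hahn_exists mu)) in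
  \int[jordan_pos h]_(x in torus R) (f x)%:E
  - \int[jordan_neg h]_(x in torus R) (f x)%:E.

Definition W1 nu mu : \bar R :=
  ereal_sup [set `|charge_integral (cadd nu (copp mu)) f| | f in @lip1 R].

End charges.

Definition expi (R : realType) (t : R) : R[i] := cos t +i* sin t.

Definition is_trigpoly (R : realType) (n : nat) (p : R -> R) :=
  exists c : int -> R[i], forall x : R,
    (p x)%:C = \sum_(j < n.*2.+1)
      let k := (j%:Z - n%:Z)%R in c k * expi (2 * pi * k%:~R * x).

(* Real-valued trigonometric polynomials of degree at most [n], as functions:
   by proof irrelevance, equality in this type is equality of functions, and
   by periodicity it is also equality on [torus]. *)
Record trigpoly (R : realType) (n : nat) := TrigPoly {
  trigpoly_fun :> R -> R;
  trigpolyP : is_trigpoly n trigpoly_fun }.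

Lemma continuous_trigpoly (R : realType) (n : nat) (p : trigpoly R n) :
  continuous (p : R -> R).
Proof.
case: p => p [c pE] /=.
have -> : p = fun x => \sum_(j < n.*2.+1)
    (complex.Re (c (j%:Z - n%:Z)) * cos (2 * pi * (j%:Z - n%:Z)%:~R * x)
     - complex.Im (c (j%:Z - n%:Z)) * sin (2 * pi * (j%:Z - n%:Z)%:~R * x)).
  apply/funext => x; have /(congr1 (@complex.Re R)) /= -> := pE x.
  rewrite raddf_sum /=; apply: eq_bigr => j _.
  by case: (c _) => a b.
apply: continuous_big => [|j _ x]; first exact: add_continuous.
apply: cvgB; (apply: cvgM; first exact: cvg_cst).
- apply: continuous_comp; last exact: continuous_cos.
  by apply: cvgM; [exact: cvg_cst|exact: cvg_id].
- apply: continuous_comp; last exact: continuous_sin.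
  by apply: cvgM; [exact: cvg_cst|exact: cvg_id].
Qed.

Lemma integrable_trigpoly (R : realType) (n : nat) (p : trigpoly R n) :
  (@lebesgue_measure R).-integrable setT (EFin \o (p \_ (torus R))).
Proof.
rewrite -restrict_EFin.
have mT : measurable (torus R) by exact: measurable_itv.
have [+ _] := integrable_mkcond (mu := @lebesgue_measure R) (EFin \o p) mT; apply.
have : (@lebesgue_measure R).-integrable `[0, 1] (EFin \o (p : R -> R)).
  apply: continuous_compact_integrable; first exact: segment_compact.
  by apply: continuous_subspaceT; exact: continuous_trigpoly.
by apply: integrableS => //; apply: subset_itvl; rewrite bnd_simp.
Qed.

(* The measure p(x) dx on the torus. *)
Definition trigpoly_charge (R : realType) (n : nat) (p : trigpoly R n) :
    {charge set (measurableTypeR R) -> \bar R} :=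
  induced_charge (integrable_trigpoly p).

Definition best_approx (R : realType) (n : nat)
    (mu : {charge set (measurableTypeR R) -> \bar R}) (p : trigpoly R n) :=
  forall q : trigpoly R n,
    (W1 (trigpoly_charge p) mu <= W1 (trigpoly_charge q) mu)%E.

(* Main.v *)
Require Import Defs.
From mathcomp Require Import all_boot all_order all_algebra complex.
From mathcomp Require Import all_classical all_reals all_analysis.
From mathcomp Require Import measurable_realfun ring lra zify.

(* In dimension one, W_1(nu, mu) is the minimum over the constants c of the L1 norm
   of H - c, where H(t) = (nu - mu)([0, t[).  Let G(t) = mu([0, t[) - t, which is
   continuous and periodic because mu is absolutely continuous of mass 1.  For
   nu = p(x) dx of mass 1, the functions c - H are the G - T where T runs over the
   trigonometric polynomials with T' = p - 1, so that p is a best approximation of mu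
   if and only if p = 1 + T' for a best L1 approximation T of G.  The latter exists
   by compactness and is unique by Jackson's argument: if S and T are both optimal,
   equality in the triangle inequality makes S - T vanish at the zeros of
   g = G - (S + T) / 2.  If S <> T, then g has at most 2n zeros, hence some
   trigonometric polynomial q of degree at most n has the same sign as g, and g - e q
   has a smaller L1 norm for small e > 0. *)

Set Implicit Arguments.
Unset Strict Implicit.
Unset Printing Implicit Defensive.

Import Order.TTheory GRing.Theory Num.Theory.
Import numFieldNormedType.Exports.

Local Open Scope classical_set_scope.
Local Open Scope ring_scope.

(** * Trigonometric polynomials *)

(** The bound 2n fits twice. After multiplication by [expi (2 * pi * n%:R * x)], a trigonometric
    polynomial is a polynomial of degree at most 2n in [expi (2 * pi * x)], which bounds its zeros.
    Conversely, a product of factors [sin (pi * (x - z))] is a trigonometric polynomial only when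
    their number is even, and then 2n factors are allowed. Prescribing signs thus meets a parity
    obstacle, which the periodicity of g removes. On the Wasserstein side, a charge is integrated
    through its Jordan parts, while only its values H(t) on the intervals [0, t[ are under control.
    Integration by parts is therefore done on uniform grids, with an error governed by the total
    variation. No Lipschitz function is differentiated: the upper bound uses increments between grid
    points, and the lower bound uses primitives of continuous functions as test functions. The
    constant c is absorbed by T, which p determines only up to a constant. Masses other than 1 are
    excluded by testing against constants. *)

Section expi.
Variable R : realType.
Implicit Types x y : R.

Lemma expi0 : expi (0 : R) = 1.
Proof. by rewrite /expi cos0 sin0. Qed.

Lemma expiD x y : expi (x + y) = expi x * expi y.
Proof. by rewrite /expi cosD sinD; simpc; congr (_ +i* _)%C; rewrite addrC. Qed.

Lemma expi_neq0 x : expi x != 0.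
Proof.
rewrite eq_complex /= negb_and -implybE; apply/implyP => /eqP cx0.
apply/eqP => sx0; have /eqP := cos2Dsin2 x.
by rewrite cx0 sx0 !expr0n addr0 eq_sym oner_eq0.
Qed.

Lemma expiMn x m : expi (m%:R * x) = expi x ^+ m.
Proof.
elim: m => [|m IH]; first by rewrite mul0r expi0.
by rewrite -natr1 mulrDl mul1r expiD IH exprSr.
Qed.

(** By the half-angle formula [cos x = 1 - 2 sin^2 (x / 2)], and the sine is positive at [|x| / 2]
    when [0 < |x| < 2 pi]. *)
Lemma cos_eq1_lt2pi x : `|x| < 2 * pi -> cos x = 1 -> x = 0.
Proof.
move=> xlt cx1; apply/eqP/negPn/negP => x0.
have : 0 < sin (`|x| / 2).
  by rewrite sin_gt0_pi// divr_gt0 ?normr_gt0//= ltr_pdivrMr// mulrC.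
have /eqP : cos (`|x| / 2 *+ 2) = 1 by rewrite -mulr_natr divfK// cos_norm.
rewrite cos_mulr2n cos2sin2 mulr2n => /eqP cE; nra.
Qed.

Lemma expi_inj01 x y : x \in `[0, 1[ -> y \in `[0, 1[ ->
  expi (2 * pi * x) = expi (2 * pi * y) -> x = y.
Proof.
rewrite !in_itv/= => /andP[x0 x1] /andP[y0 y1] [cE sE].
have p0 : 0 < (pi : R) := pi_gt0 R.
have : 2 * pi * (x - y) = 0.
  apply: cos_eq1_lt2pi; last by rewrite mulrBr cosB cE sE -!expr2 cos2Dsin2.
  rewrite normrM gtr0_norm ?mulr_gt0// gtr_pMr ?mulr_gt0// ltr_norml.
  by apply/andP; split; lra.
by move=> /eqP; rewrite !mulf_eq0 pnatr_eq0/= (gt_eqF p0)/= subr_eq0 => /eqP.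
Qed.

End expi.

Section trigonometric_polynomials.
Variables (R : realType) (n : nat).
Implicit Types (p q : R -> R) (a b : 'I_n.*2.+1 -> R).

Definition freq (j : 'I_n.*2.+1) : R := 2 * pi * (j%:Z - n%:Z)%:~R.

(** Real part of the sum with complex coefficients [a j + i b j]. The families are not unique, since
    [j] and [rev_ord j] carry opposite frequencies. *)
Definition trig a b (x : R) : R :=
  \sum_j (a j * cos (freq j * x) - b j * sin (freq j * x)).

Lemma is_trigpoly_trig p : is_trigpoly n p -> exists a b, p = trig a b.
Proof.
case=> c pE.
exists (fun j => complex.Re (c (j%:Z - n%:Z))),
  (fun j => complex.Im (c (j%:Z - n%:Z))).
apply/funext => x; have /(congr1 (@complex.Re R)) /= -> := pE x.
rewrite raddf_sum /=; apply: eq_bigr => j _.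
by case: (c _) => u v.
Qed.

Lemma freq_rev (j : 'I_n.*2.+1) : freq (rev_ord j) = - freq j.
Proof.
rewrite /freq -mulrN -mulrNz; congr (_ * _%:~R).
by case: j => j /= jn; rewrite /=; lia.
Qed.

(** The complex sum with coefficients [a j + i b j] need not be real. Averaging over [j] and
    [rev_ord j] gives the same real function with conjugate coefficients at opposite frequencies, so
    that the imaginary parts cancel. *)
Lemma trig_is_trigpoly a b : is_trigpoly n (trig a b).
Proof.
pose idx (k : int) : 'I_n.*2.+1 := inord `|k + n%:Z|.
have idxE (j : 'I_n.*2.+1) : idx (j%:Z - n%:Z) = j.
  by apply/val_inj; rewrite /idx subrK absz_nat /= inordK.
pose u j : R := (a j + a (rev_ord j)) / 2.
pose v j : R := (b j - b (rev_ord j)) / 2.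
exists (fun k => (u (idx k) +i* v (idx k))%C) => x.
have -> : trig a b x = trig u v x.
  have trig_rev : trig a b x = trig (a \o @rev_ord _) (fun j => - b (rev_ord j)) x.
    rewrite /trig (reindex_inj rev_ord_inj)/=; apply: eq_bigr => j _.
    by rewrite freq_rev mulNr cosN sinN; ring.
  have -> : trig a b x = (trig a b x + trig a b x) / 2 by field.
  rewrite {2}trig_rev /trig -big_split mulr_suml /=.
  by apply: eq_bigr => j _; rewrite /u /v; field.
rewrite /trig.
have imz : \sum_j (u j * sin (freq j * x) + v j * cos (freq j * x)) = 0 :> R.
  set s := \sum_j _; suff : s = - s by move=> ?; lra.
  rewrite {1}/s (reindex_inj rev_ord_inj)/= -sumrN; apply: eq_bigr => j _.
  by rewrite freq_rev mulNr cosN sinN /u /v rev_ordK; field.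
apply/eqP; rewrite eq_complex/= !raddf_sum/=.
apply/andP; split; apply/eqP.
  by apply: eq_bigr => j _; rewrite idxE /expi /freq; simpc.
by rewrite -[LHS]imz; apply: eq_bigr => j _; rewrite idxE /expi /freq; simpc.
Qed.

End trigonometric_polynomials.

Section trigonometric_polynomials_as_polynomials.
Variables (R : realType) (n : nat).
Implicit Types (p q : R -> R).

Lemma is_trigpoly_lin (u v : R) p q : is_trigpoly n p -> is_trigpoly n q ->
  is_trigpoly n (fun x => u * p x + v * q x).
Proof.
move=> [c pE] [d qE]; exists (fun k => u%:C%C * c k + v%:C%C * d k) => x.
rewrite rmorphD !rmorphM/= pE qE !mulr_sumr -big_split/=.
by apply: eq_bigr => j _ /=; rewrite [RHS]mulrDl !mulrA.
Qed.

Lemma expi_shift (j : nat) (x : R) :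
  expi (2 * pi * (j%:Z - n%:Z)%:~R * x) * expi (2 * pi * n%:R * x)
  = expi (2 * pi * x) ^+ j.
Proof.
rewrite -expiD -expiMn; congr expi.
by rewrite intrB; ring.
Qed.

(** The extra factor moves the frequencies from -n, ..., n to 0, ..., 2n, so that zeros of [p]
    become roots of [P] on the unit circle. *)
Lemma is_trigpoly_poly p : is_trigpoly n p -> exists P : {poly R[i]},
  (size P <= n.*2.+1)%N /\
  forall x, (p x)%:C%C * expi (2 * pi * n%:R * x) = P.[expi (2 * pi * x)].
Proof.
move=> [c pE]; exists (\poly_(j < n.*2.+1) c (j%:Z - n%:Z)); split.
  exact: size_poly.
move=> x; rewrite pE horner_poly mulr_suml; apply: eq_bigr => j _ /=.
by rewrite -mulrA expi_shift.
Qed.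

Lemma poly_is_trigpoly p (P : {poly R[i]}) : (size P <= n.*2.+1)%N ->
  (forall x, (p x)%:C%C * expi (2 * pi * n%:R * x) = P.[expi (2 * pi * x)]) ->
  is_trigpoly n p.
Proof.
move=> sP pE; exists (fun k => P`_(absz (k + n%:Z)%R)) => x.
apply: (mulIf (expi_neq0 (2 * pi * n%:R * x))).
rewrite pE (horner_coef_wide _ sP) mulr_suml; apply: eq_bigr => j _ /=.
by rewrite -[RHS]mulrA expi_shift subrK.
Qed.

Lemma trigpoly_zeros p : is_trigpoly n p -> (exists x, p x != 0) ->
  exists s : seq R, (size s <= n.*2)%N /\
    forall x, x \in `[0, 1[ -> p x = 0 -> x \in s.
Proof.
move=> /is_trigpoly_poly[P [sP pE]] [x0 px0].
have P0 : P != 0.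
  apply: contra_neq px0 => P0; have := pE x0.
  rewrite P0 horner0 => /eqP; rewrite mulf_eq0 (negbTE (expi_neq0 _)) orbF.
  by move=> /eqP[].
have [r PE] := closed_field_poly_normal P.
(* The angle of a root on the unit circle, unique by [expi_inj01]; roots off the circle get the
   harmless default 0. *)
pose arg (z : R[i]) : R :=
  xget 0 [set x : R | (x \in `[0, 1[) /\ expi (2 * pi * x) = z].
exists (map arg r); split.
  move: sP; rewrite PE size_scale ?lead_coef_eq0//.
  by rewrite size_prod_XsubC size_map.
move=> x x01 px; have := pE x; rewrite px mul0r PE hornerZ => /esym/eqP.
rewrite mulf_eq0 lead_coef_eq0 (negbTE P0)/= -[_ == 0]/(root _ _).
rewrite root_prod_XsubC => xr; apply/mapP; exists (expi (2 * pi * x)) => //.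
rewrite /arg; case: xgetP => [y _ [y01 yE]|/(_ x)]; last by case.
by apply: expi_inj01.
Qed.

(** Each sine has the half-integer frequencies 1/2 and -1/2; an even number 2h of factors combines
    them into integers between -h and h. *)
Lemma sin_prod_is_trigpoly (s : seq R) : ~~ odd (size s) ->
  (size s <= n.*2)%N -> is_trigpoly n (fun x => \prod_(z <- s) sin (pi * (x - z))).
Proof.
move=> es sn.
have sinE (x z : R) : (sin (pi * (x - z)))%:C%C * expi (pi * x) =
  expi (- (pi * z)) / (2 * 'i)%C * (expi (2 * pi * x) - expi (2 * pi * z)).
  have i2 : (2 * 'i)%C != 0 :> R[i].
    by rewrite mulf_neq0 ?pnatr_eq0// eq_complex/= oner_eq0 andbF.
  apply: (mulfI i2); rewrite [RHS]mulrA [_ * (_ / _)]mulrC divfK//.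
  rewrite [RHS]mulrBr -!expiD /expi.
  have -> : - (pi * z) + 2 * pi * x = pi * (x - z) + pi * x by ring.
  have -> : - (pi * z) + 2 * pi * z = - (pi * (x - z)) + pi * x by ring.
  rewrite !cosD !sinD cosN sinN; simpc.
  by congr (_ +i* _)%C; ring.
pose h := (size s)./2.
have sE : size s = h.*2 by rewrite /h even_halfK.
have hn : (h <= n)%N by rewrite -leq_double -sE.
pose k := \prod_(z <- s) (expi (- (pi * z)) / (2 * 'i)%C : R[i]).
(* The 2h half-frequency factors only account for a shift by h; ['X^(n - h)] supplies the rest of
   the shift by n. *)
apply: (@poly_is_trigpoly _
  (k *: ('X^(n - h) * \prod_(z <- s) ('X - (expi (2 * pi * z))%:P)))).
  rewrite (leq_trans (size_scale_leq _ _))// (leq_trans (size_polyMleq _ _))//.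
  rewrite size_polyXn -(big_map (fun z => expi (2 * pi * z)) xpredT
    (fun z => 'X - z%:P)) size_prod_XsubC size_map sE.
  by lia.
move=> x; rewrite hornerZ hornerM hornerXn horner_prod.
have -> : expi (2 * pi * n%:R * x) =
    expi (2 * pi * x) ^+ (n - h) * expi (pi * x) ^+ size s.
  rewrite -!expiMn -expiD sE natrB// -muln2 natrM; congr expi; ring.
rewrite mulrCA [RHS]mulrCA; congr (_ * _).
rewrite /k; elim: (s) => [|z t IH]; first by rewrite !big_nil expr0.
rewrite !big_cons rmorphM exprS mulrACA sinE IH /= hornerXsubC.
by rewrite [RHS]mulrACA.
Qed.

End trigonometric_polynomials_as_polynomials.

(** * Integrals over the unit interval and Fourier coefficients *)

Notation int01 f := (\int[@lebesgue_measure _]_(x in `[0, 1]) f x).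

Section continuous_real_functions.
Variable R : realType.
Implicit Types f g : R -> R.

Lemma fctM_continuous f g : continuous f -> continuous g ->
  continuous (fun x => f x * g x).
Proof. by move=> cf cg x; apply: (@cvgM _ _ _ _ f g); [exact: cf|exact: cg]. Qed.

Lemma fctD_continuous f g : continuous f -> continuous g ->
  continuous (fun x => f x + g x).
Proof. by move=> cf cg x; apply: (@cvgD _ _ _ _ _ f g); [exact: cf|exact: cg]. Qed.

Lemma fctB_continuous f g : continuous f -> continuous g ->
  continuous (fun x => f x - g x).
Proof. by move=> cf cg x; apply: (@cvgB _ _ _ _ _ f g); [exact: cf|exact: cg]. Qed.

Lemma fctZ_continuous (r : R) f : continuous f -> continuous (fun x => r * f x).
Proof. by move=> cf; apply: fctM_continuous cf => x; exact: cvg_cst. Qed.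

Lemma fct_norm_continuous f : continuous f -> continuous (fun x => `|f x|).
Proof. by move=> cf x; apply: (@cvg_norm _ _ _ _ _ f); exact: cf. Qed.

Lemma fct_absB_continuous f g : continuous f -> continuous g ->
  continuous (fun x => `|f x - g x|).
Proof. by move=> cf cg; exact/fct_norm_continuous/fctB_continuous. Qed.

End continuous_real_functions.

Section integrals.
Variable R : realType.
Implicit Types (f g F : R -> R) (a b : R).
Local Notation leb := (@lebesgue_measure R).

Lemma continuous_integrable_itv f a b : continuous f ->
  leb.-integrable `[a, b] (EFin \o f).
Proof.
move=> cf; apply: continuous_compact_integrable; first exact: segment_compact.
by apply: continuous_subspaceT => x; exact: cf.
Qed.

Lemma Rintegral_FTC2 f F a b : a <= b -> continuous f ->
  (forall x : R, is_derive x 1 F (f x)) ->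
  \int[leb]_(x in `[a, b]) f x = F b - F a.
Proof.
rewrite le_eqVlt => /predU1P[<- _ _|ab cf dF].
  by rewrite set_itv1 Rintegral_set1 subrr.
have cF : continuous F.
  by move=> x; apply/differentiable_continuous/derivable1_diffP; have [] := dF x.
rewrite /Rintegral (@continuous_FTC2 _ f F)//.
- exact: continuous_subspaceT.
- split; first by move=> x _.
  + exact/cvg_at_right_filter/cF.
  + exact/cvg_at_left_filter/cF.
- by move=> x _; rewrite derive1E; exact: derive_val.
Qed.

Lemma le_int01 f g : continuous f -> continuous g ->
  (forall x, x \in `[0, 1] -> f x <= g x) -> int01 f <= int01 g.
Proof.
move=> cf cg fg; apply: le_Rintegral => //; exact: continuous_integrable_itv.
Qed.

Lemma int01D f g : continuous f -> continuous g ->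
  int01 (fun x => f x + g x) = int01 f + int01 g.
Proof. by move=> cf cg; rewrite RintegralD//; exact: continuous_integrable_itv. Qed.

Lemma int01B f g : continuous f -> continuous g ->
  int01 (fun x => f x - g x) = int01 f - int01 g.
Proof. by move=> cf cg; rewrite RintegralB//; exact: continuous_integrable_itv. Qed.

Lemma int01Z r f : continuous f -> int01 (fun x => r * f x) = r * int01 f.
Proof. by move=> cf; rewrite RintegralZl//; exact: continuous_integrable_itv. Qed.

Lemma int01_cst r : int01 (fun=> r : R) = r.
Proof.
by rewrite Rintegral_cst//= lebesgue_measure_itv/= lte_fin ltr01 oppr0 adde0 mulr1.
Qed.

Lemma int01_sum (I : Type) (s : seq I) (f : I -> R -> R) :
  (forall i, continuous (f i)) ->
  int01 (fun x => \sum_(i <- s) f i x) = \sum_(i <- s) int01 (f i).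
Proof.
move=> cf; elim: s => [|i s IH].
  under eq_Rintegral do rewrite big_nil.
  by rewrite big_nil int01_cst.
under eq_Rintegral do rewrite big_cons.
rewrite big_cons -IH int01D//; apply: continuous_big => //.
exact: add_continuous.
Qed.

End integrals.

Section trigonometric_calculus.
Variables (R : realType) (n : nat).
Implicit Types (a b : 'I_n.*2.+1 -> R) (w A B c x : R).
Local Notation freq := (@freq R n).

(** Differentiation multiplies the complex amplitude [A + i B] by [i w]. The phase [c] serves the
    convolution with the Dirichlet kernel. *)
Lemma wave_derive A B w c x :
  is_derive x 1 (fun y => A * cos (w * y + c) - B * sin (w * y + c))
    (- w * B * cos (w * x + c) - w * A * sin (w * x + c)).
Proof.
have dlin : is_derive x 1 (fun y : R => w * y + c) w.
  have := is_deriveD (is_deriveZ w (is_derive_id x (1 : R)))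
    (is_derive_cst c x (1 : R)).
  by move=> /is_derive_eq; apply; rewrite addr0 /GRing.scale/= mulr1.
have dcos := @is_derive1_comp _ cos (fun y => w * y + c) _ _ _ (is_derive_cos _) dlin.
have dsin := @is_derive1_comp _ sin (fun y => w * y + c) _ _ _ (is_derive_sin _) dlin.
have := is_deriveB (is_deriveZ A dcos) (is_deriveZ B dsin).
by move=> /is_derive_eq; apply; rewrite /GRing.scale/=; ring.
Qed.

Lemma trig_derive a b x : is_derive x 1 (trig a b)
  (trig (fun j => - freq j * b j) (fun j => freq j * a j) x).
Proof.
have -> : trig a b = \sum_j
    (fun y => a j * cos (freq j * y + 0) - b j * sin (freq j * y + 0)).
  by apply/funext => y; rewrite fct_sumE; apply: eq_bigr => j _; rewrite !addr0.
have /is_derive_eq := is_derive_sum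
  (fun j => wave_derive (a j) (b j) (freq j) 0 x).
by apply; apply: eq_bigr => j _; rewrite addr0.
Qed.

Lemma continuous_trig a b : continuous (trig a b).
Proof.
move=> x; apply/differentiable_continuous/derivable1_diffP.
by have [] := trig_derive a b x.
Qed.

Definition mid : 'I_n.*2.+1 := inord n.

Lemma freq_eq0 (j : 'I_n.*2.+1) : (freq j == 0) = (j == mid).
Proof.
rewrite /freq mulf_eq0 intr_eq0 subr_eq0 mulf_eq0 pnatr_eq0/= (gt_eqF (pi_gt0 R)).
by rewrite -(inj_eq val_inj) /= inordK// -addnn; lia.
Qed.

(** The second summand has the shape that [trig_derive] produces, with the amplitudes divided by
    [i freq j]. At [mid] the frequency is 0, so only the constant [a mid] survives there and is
    split off. *)
Lemma trig_antiderivative a b x :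
  trig a b x = a mid + trig (fun j => - freq j * (- a j / freq j))
    (fun j => freq j * (b j / freq j)) x.
Proof.
rewrite /trig (bigD1 mid)//= [in RHS](bigD1 mid)//=.
have /eqP f0 : freq mid == 0 by rewrite freq_eq0.
rewrite !f0 !mul0r cos0 sin0 !(mulr0, mul0r, mulr1, subr0, oppr0, add0r); congr +%R.
apply: eq_bigr => j; rewrite -freq_eq0 => fj.
by congr (_ * _ - _ * _); field.
Qed.

Lemma expi_int (k : int) : expi (2 * pi * k%:~R) = 1 :> R[i].
Proof.
have nat_case m : expi (2 * pi * m%:R) = 1 :> R[i].
  rewrite mulrC expiMn (_ : expi _ = 1) ?expr1n//.
  by rewrite mulrC mulr_natr /expi cos2pi sin2pi.
case: k => m; first exact: nat_case.
rewrite NegzE mulrNz mulrN -pmulrn; apply: (mulIf (expi_neq0 (2 * pi * m.+1%:R))).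
by rewrite -expiD addNr expi0 nat_case mulr1.
Qed.

Lemma cos_int (k : int) c : cos (2 * pi * k%:~R + c) = cos c :> R.
Proof. by have [ck sk] := expi_int k; rewrite cosD ck sk mul1r mul0r subr0. Qed.

Lemma sin_int (k : int) c : sin (2 * pi * k%:~R + c) = sin c :> R.
Proof. by have [ck sk] := expi_int k; rewrite sinD ck sk mul1r mul0r add0r. Qed.

Lemma freqE (j : 'I_n.*2.+1) : freq j = 2 * pi * (j%:Z - n%:Z)%:~R.
Proof. by []. Qed.

Lemma trig_period a b : trig a b 1 = trig a b 0.
Proof.
rewrite /trig; apply: eq_bigr => j _; rewrite mulr1 mulr0 -[freq j]addr0.
by rewrite freqE cos_int sin_int.
Qed.

Lemma continuous_wave A B w c :
  continuous (fun y => A * cos (w * y + c) - B * sin (w * y + c)).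
Proof.
move=> x; apply/differentiable_continuous/derivable1_diffP.
by have [] := wave_derive A B w c x.
Qed.

Lemma int01_wave A B c (k : int) : let w := 2 * pi * k%:~R in
  int01 (fun y => A * cos (w * y + c) - B * sin (w * y + c)) =
  (k == 0)%:R * (A * cos c - B * sin c).
Proof.
move=> w; have [k0|k0] := eqVneq k 0.
  rewrite /w k0 mulr0; under eq_Rintegral do rewrite mul0r add0r.
  by rewrite int01_cst mul1r.
have w0 : w != 0 by rewrite !mulf_neq0// ?intr_eq0// gt_eqF ?pi_gt0.
have dF x : is_derive x 1
    (fun y => B / w * cos (w * y + c) - (- A / w) * sin (w * y + c))
    (A * cos (w * x + c) - B * sin (w * x + c)).
  have /is_derive_eq := wave_derive (B / w) (- A / w) w c x.
  by apply; congr (_ * _ - _ * _); field.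
rewrite (Rintegral_FTC2 ler01 _ dF); last exact: continuous_wave.
by rewrite mulr1 mulr0 add0r cos_int sin_int subrr mul0r.
Qed.

Lemma int01_trig a b : int01 (trig a b) = a mid.
Proof.
transitivity (int01 (fun x => a mid + trig (fun j => - freq j * (- a j / freq j))
    (fun j => freq j * (b j / freq j)) x)).
  by apply: eq_Rintegral => x _; exact: trig_antiderivative.
rewrite int01D; [|by move=> x; exact: cvg_cst|exact: continuous_trig].
rewrite int01_cst (Rintegral_FTC2 ler01 (@continuous_trig _ _)
  (trig_derive (fun j => b j / freq j) (fun j => - a j / freq j))).
by rewrite trig_period subrr addr0.
Qed.

(* The Dirichlet kernel [\sum_k cos (freq k * (y - x))] reproduces [p]. *)
Lemma trig_fourier a b (p := trig a b) :
  p = trig (fun k => int01 (fun y => p y * cos (freq k * y)))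
           (fun k => - int01 (fun y => p y * sin (freq k * y))).
Proof.
apply/funext => x.
have cf k : continuous (fun y : R => freq k * y).
  by apply: fctZ_continuous => y; exact: cvg_id.
have cc k : continuous (fun y : R => cos (freq k * y)).
  by move=> y; apply: continuous_comp; [exact: cf|exact: continuous_cos].
have cs k : continuous (fun y : R => sin (freq k * y)).
  by move=> y; apply: continuous_comp; [exact: cf|exact: continuous_sin].
have cp : continuous p := @continuous_trig a b.
transitivity (\sum_k \sum_j int01 (fun y =>
    (a j * cos (freq j * y) - b j * sin (freq j * y))
      * cos (freq k * y - freq k * x))); last first.
  apply: eq_bigr => k _.
  rewrite mulNr opprK [X in _ = X + _]mulrC [X in _ = _ + X]mulrC.
  rewrite -!int01Z; [|exact: fctM_continuous..].
  rewrite -int01D; [|exact/fctZ_continuous/fctM_continuous..].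
  rewrite -int01_sum; last first.
    move=> j; apply: fctM_continuous.
      by apply: fctB_continuous; exact: fctZ_continuous.
    move=> y; apply: continuous_comp; last exact: continuous_cos.
    by apply: fctB_continuous => // z; exact: cvg_cst.
  by apply: eq_Rintegral => y _; rewrite -mulr_suml -/(trig a b y) -/p cosB; ring.
rewrite exchange_big; apply: eq_bigr => j _ /=.
(* The product of the two waves splits into frequencies [freq j + freq k] and [freq j - freq k].
   Only [k = rev_ord j] and [k = j] leave a nonzero mean, and each contributes half of [wv]; for
   [j = mid] the two coincide and both halves count. *)
pose wv := a j * cos (freq j * x) - b j * sin (freq j * x).
transitivity (\sum_k (((k == rev_ord j)%:R / 2 * wv + (k == j)%:R / 2 * wv))).
  rewrite big_split/= -!mulr_suml.
  rewrite (bigD1 (rev_ord j))//= big1 => [|k /negbTE ->//].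
  rewrite (bigD1 j)//= big1 => [|k /negbTE ->//].
  by rewrite !eqxx !addr0 mulr1n /wv; field.
apply: eq_bigr => k _.
pose k1 : int := (j%:Z - n%:Z) + (k%:Z - n%:Z).
pose k2 : int := (j%:Z - n%:Z) - (k%:Z - n%:Z).
have k10 : (k1 == 0) = (k == rev_ord j).
  by rewrite -(inj_eq val_inj)/= /k1; have := ltn_ord j; lia.
have k20 : (k2 == 0) = (k == j) by rewrite -(inj_eq val_inj)/= /k2; lia.
have fk1 : 2 * pi * k1%:~R = freq j + freq k by rewrite intrD mulrDr.
have fk2 : 2 * pi * k2%:~R = freq j - freq k by rewrite intrB mulrBr.
have I1 := int01_wave (a j) (b j) (- (freq k * x)) k1.
have I2 := int01_wave (a j) (b j) (freq k * x) k2.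
transitivity (
  2^-1 * ((k1 == 0)%:R *
    (a j * cos (- (freq k * x)) - b j * sin (- (freq k * x))))
  + 2^-1 * ((k2 == 0)%:R * (a j * cos (freq k * x) - b j * sin (freq k * x)))).
  rewrite k10 k20; congr (_ + _).
    have [->|_] := eqVneq k (rev_ord j); last by rewrite !mul0r mulr0.
    by rewrite freq_rev !mulNr !opprK /wv; ring.
  by have [->|_] := eqVneq k j; rewrite ?mul0r ?mulr0// /wv; ring.
rewrite -I1 -I2 -!int01Z; [|exact: continuous_wave..].
rewrite -int01D; [|exact/fctZ_continuous/continuous_wave..].
apply: eq_Rintegral => y _; rewrite fk1 fk2.
have -> : (freq j + freq k) * y - freq k * x = freq j * y + (freq k * y - freq k * x).
  by ring.
have -> : (freq j - freq k) * y + freq k * x = freq j * y - (freq k * y - freq k * x).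
  by ring.
move: (freq j * y) (freq k * y - freq k * x) => u v.
by rewrite cosD sinD cosB sinB; field.
Qed.

End trigonometric_calculus.

(** * Best L1 approximation *)

Lemma int01_norm_le (R : realType) (f : R -> R) : continuous f ->
  `|int01 f| <= int01 (fun x => `|f x|).
Proof.
by move=> cf; apply: le_normr_Rintegral => //; exact: continuous_integrable_itv.
Qed.

Section L1_best_approximation_existence.
Variables (R : realType) (n : nat) (G : R -> R).
Hypothesis cG : continuous G.
Local Notation N := (n.*2.+1).

Definition rV_trig (v : 'rV[R]_(N + N)) : R -> R :=
  trig (fun j => v 0 (lshift N j)) (fun j => v 0 (rshift N j)).

Lemma continuous_rV_trig v : continuous (rV_trig v).
Proof. exact: continuous_trig. Qed.

Lemma trig_rV_trig (a b : 'I_N -> R) :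
  trig a b = rV_trig (row_mx (\row_j a j) (\row_j b j)).
Proof.
apply/funext => x; apply: eq_bigr => j _.
by rewrite row_mxEl row_mxEr !mxE.
Qed.

Lemma rV_trig_lip v w x :
  `|rV_trig v x - rV_trig w x| <= (N + N)%:R * `|v - w|.
Proof.
have vwj j : `|v 0 j - w 0 j| <= `|v - w|.
  rewrite [`|v - w|]mx_normrE.
  have := le_bigmax 0 (fun ij : 'I_1 * 'I_(N + N) => `|(v - w) ij.1 ij.2|) (0, j).
  by rewrite !mxE.
rewrite /rV_trig /trig -sumrB (le_trans (ler_norm_sum _ _ _))//.
apply: (@le_trans _ _ (\sum_(j < N) (`|v - w| + `|v - w|))); last first.
  by rewrite sumr_const card_ord -mulr_natl natrD; lra.
apply: ler_sum => j _.
have Ej (a b c d u t : R) : a * u - b * t - (c * u - d * t) =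
  (a - c) * u - (b - d) * t by ring.
rewrite Ej (le_trans (ler_normB _ _))// lerD// normrM.
  by rewrite (le_trans _ (vwj (lshift N j)))// ler_piMr// cos_max.
by rewrite (le_trans _ (vwj (rshift N j)))// ler_piMr// sin_max.
Qed.

Let Psi v := int01 (fun x => `|G x - rV_trig v x|).

Let Psi_lip v w : Psi v <= Psi w + (N + N)%:R * `|v - w|.
Proof.
rewrite -[X in _ + X]int01_cst -int01D; last 2 first.
- exact/fct_absB_continuous/continuous_rV_trig.
- by move=> x; exact: cvg_cst.
apply: le_int01.
- exact/fct_absB_continuous/continuous_rV_trig.
- apply: fctD_continuous; first exact/fct_absB_continuous/continuous_rV_trig.
  by move=> x; exact: cvg_cst.
- move=> x _; rewrite -(subrKA (rV_trig w x)) (le_trans (ler_normD _ _))//.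
  by rewrite lerD2l distrC rV_trig_lip.
Qed.

Let continuous_Psi : continuous Psi.
Proof.
move=> v; apply/(@cvgrPdist_lt _ _ _ (nbhs v) (nbhs_filter v)) => e e0.
apply: ((@nbhs_normP _ 'rV[R]_(N + N) v (fun w => `|Psi v - Psi w| < e)).2 _).
exists ((N + N)%:R^-1 * e); first by rewrite /= mulr_gt0// invr_gt0 ltr0n.
move=> w /=; rewrite ltr_pdivlMl ?ltr0n//; apply: le_lt_trans.
rewrite ler_norml lerNl opprB !lerBlDl; apply/andP; split.
  by rewrite distrC; exact: Psi_lip.
exact: Psi_lip.
Qed.

(** The error does not tend to infinity with the coefficients, because distinct coefficient vectors
    may give the same function. [trig_fourier] selects a representative whose coefficients are
    bounded by the L1 norm of the function, so a compact box is enough. *)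
Lemma L1_best_approx_exists : exists T : R -> R, is_trigpoly n T /\
  forall S : R -> R, is_trigpoly n S ->
    int01 (fun x => `|G x - T x|) <= int01 (fun x => `|G x - S x|).
Proof.
(* If [S] does at least as well as 0, then the L1 norm of [S] is at most that of [G - S] plus that
   of [G], hence at most [K]. *)
pose K := 2 * int01 (fun x => `|G x|).
have K0 : 0 <= K by rewrite mulr_ge0// Rintegral_ge0.
pose A := [set v : 'rV[R]_(N + N) | forall j, `[- K, K]%classic (v 0 j)].
have A0 : A 0 by move=> j /=; rewrite mxE in_itv/= oppr_le0 K0.
have cA : compact A.
  by apply: (@rV_compact R _ (fun=> `[- K, K]%classic)) => j; exact: segment_compact.
have [v _ vmin] := compact_EVT_min (ex_intro _ _ A0) cA
  (continuous_subspaceT continuous_Psi).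
exists (rV_trig v); split; first exact: trig_is_trigpoly.
have Psi0 : Psi 0 = int01 (fun x => `|G x|).
  apply: eq_Rintegral => x _; congr `|_|; rewrite /rV_trig /trig big1 ?subr0// => j _.
  by rewrite !mxE !mul0r subr0.
move=> S /is_trigpoly_trig[a [b SE]].
have cS : continuous S by rewrite SE; exact: continuous_trig.
have cG' := fct_norm_continuous cG; have cGS := fct_absB_continuous cG cS.
have [Sle|/ltW Sge] := leP (int01 (fun x => `|G x - S x|)) (int01 (fun x => `|G x|));
  last first.
  apply: le_trans Sge; rewrite -Psi0; apply: vmin; exact: mem_set.
have SK : int01 (fun x => `|S x|) <= K.
  apply: (@le_trans _ _ (int01 (fun x => `|G x - S x| + `|G x|))).
    apply: le_int01 => [||x _]; first exact: fct_norm_continuous.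
      exact: fctD_continuous.
    by rewrite -(subrK (G x) (S x)) (le_trans (ler_normD _ _))// subrK distrC.
  by rewrite int01D// /K mulrC mulr_natr mulr2n lerD2r.
have coef (w : R -> R) : continuous w -> (forall y, `|w y| <= 1) ->
    `|int01 (fun y => S y * w y)| <= K.
  move=> cw w1; apply: le_trans SK.
  apply: (le_trans (int01_norm_le (fctM_continuous cS cw))).
  apply: le_int01 => [||x _]; first exact/fct_norm_continuous/fctM_continuous.
    exact: fct_norm_continuous.
  by rewrite normrM ler_piMr.
have := trig_fourier a b; cbv zeta; rewrite -SE trig_rV_trig => ->.
apply: vmin; apply: mem_set => j /=; rewrite in_itv/= -ler_norml.
have clin w : continuous (fun y : R => w * y).
  by apply: fctZ_continuous => y; exact: cvg_id.
rewrite mxE; case: splitP => k _; rewrite !mxE ?normrN.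
  apply: coef => [|y]; last exact: cos_max.
  by move=> y; apply: continuous_comp; [exact: clin|exact: continuous_cos].
apply: coef => [|y]; last exact: sin_max.
by move=> y; apply: continuous_comp; [exact: clin|exact: continuous_sin].
Qed.

End L1_best_approximation_existence.

(** * Zeros and sign changes of continuous functions *)

Section continuous_on_unit_interval.
Variable R : realType.
Implicit Types (f g : R -> R) (s t : seq R).
Local Notation leb := (@lebesgue_measure R).

Lemma continuous_ge0_closure f : continuous f ->
  (forall x, x \in `]0, 1[ -> 0 <= f x) -> forall x, x \in `[0, 1] -> 0 <= f x.
Proof.
move=> cf f0 x; rewrite in_itv/= => /andP[x0 x1]; rewrite leNgt; apply/negP => fx.
have /cvgrPdist_lt/(_ (- f x)) : f y @[y --> x] --> f x by exact: cf.
rewrite oppr_gt0 => /(_ fx)/nbhs_normP[d /= d0 dP].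
pose e := Num.min (d / 2) 4^-1.
have e0 : 0 < e by rewrite lt_min divr_gt0//= invr_gt0 ltr0n.
have ed : e < d.
  by rewrite (@le_lt_trans _ _ (d / 2))// ?ge_min ?lexx// ltr_pdivrMr// ltr_pMr// ltr1n.
have e1 : e <= 4^-1 by rewrite ge_min lexx orbT.
(* A step of at most 1/4 towards the far end of the interval lands strictly inside it, even when [x]
   is an endpoint. *)
pose y := if x <= 2^-1 then x + e else x - e.
have xy : `|x - y| < d.
  by rewrite /y; case: ifP => _; rewrite ltr_norml; apply/andP; split; lra.
have y01 : y \in `]0, 1[.
  by rewrite in_itv/= /y; case: (leP x 2^-1) => x2; apply/andP; split; lra.
have := dP y xy; have := f0 y y01.
by rewrite ltr_norml => fy /andP[]; lra.
Qed.

Lemma int01_eq0 f : continuous f -> (forall x, x \in `[0, 1] -> 0 <= f x) ->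
  int01 f = 0 -> forall x, x \in `[0, 1] -> f x = 0.
Proof.
move=> cf f0 If; suff f00 : forall x, x \in `]0, 1[ -> 0 <= - f x.
  move=> x x01; apply/eqP; rewrite eq_le f0// andbT -oppr_ge0.
  apply: (@continuous_ge0_closure (fun x => - f x)) x01; last exact: f00.
  by move=> y; apply: (@cvgN _ _ _ _ _ f); exact: cf.
move=> x x01; rewrite oppr_ge0 leNgt; apply/negP => fx.
have /cvgrPdist_lt/(_ (f x / 2)) : f y @[y --> x] --> f x by exact: cf.
rewrite divr_gt0// => /(_ isT)/nbhs_normP[d /= d0 dP].
move: x01; rewrite in_itv/= => /andP[x0 x1].
(* On [[a, x]] the function stays above [f x / 2]; left neighbours suffice because [x > 0]. *)
pose a := Num.max 0 (x - d / 2).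
have ax : a < x by rewrite gt_max x0/= ltrBlDr ltrDl divr_gt0.
have a0 : 0 <= a by rewrite le_max lexx.
have ad : x - d / 2 <= a by rewrite le_max lexx orbT.
clearbody a.
have ax01 : `[a, x] `<=` `[0, 1]%classic.
  by move=> y /=; rewrite !in_itv/= => /andP[ay yx]; apply/andP; split; lra.
have : ((f x / 2 * (x - a))%:E <= (int01 f)%:E)%E.
  rewrite /Rintegral fineK; last first.
    by apply: integrable_fin_num => //; exact: continuous_integrable_itv.
  apply: (@le_trans _ _ (\int[leb]_(y in `[a, x]) (f y)%:E)%E).
    rewrite (_ : _%:E = \int[leb]_(y in `[a, x]) (f x / 2)%:E)%E; last first.
      rewrite integral_cst//= lebesgue_measure_itv/= lte_fin ax -EFinB.
      by rewrite -EFinM.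
    apply: le_integral => //.
    - by apply: (@continuous_integrable_itv _ (fun=> f x / 2)) => y; exact: cvg_cst.
    - exact: continuous_integrable_itv.
    - move=> y; rewrite inE/= in_itv/= => /andP[ay yx]; rewrite lee_fin.
      have : `|x - y| < d by rewrite ger0_norm; lra.
      by move=> /dP; rewrite ltr_norml => /andP[]; lra.
  apply: ge0_subset_integral => //.
    by have /integrableP[] := @continuous_integrable_itv _ f 0 1 cf.
rewrite If lee_fin leNgt => /negP; apply.
by rewrite mulr_gt0 ?divr_gt0// subr_gt0.
Qed.

Lemma constant_sign g a b : continuous g ->
  (forall x, x \in `]a, b[ -> g x != 0) ->
  exists2 c, c != 0 & forall x, x \in `]a, b[ -> 0 < c * g x.
Proof.
move=> cg g0; have [ab|ba] := ltP a b; last first.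
  by exists 1 => // x; rewrite in_itv/= => /andP[/lt_trans h /h]; rewrite ltNge ba.
pose m := (a + b) / 2.
have mab : m \in `]a, b[ by rewrite in_itv/= /m; apply/andP; split; lra.
exists (g m) => [|x xab]; first exact: g0.
rewrite ltNge; apply/negP => gmx.
have hcommon u v : u \in `]a, b[ -> v \in `]a, b[ -> u <= v -> g u * g v <= 0 -> False.
  move=> uab vab uv guv.
  have [|w wuv gw] := @IVT R g u v 0 uv (continuous_subspaceT cg).
    rewrite ge_min le_max.
    have gu0 := g0 u uab; have gv0 := g0 v vab.
    case: (ltgtP (g u) 0) gu0 => // gu _; case: (ltgtP (g v) 0) gv0 => // gv _.
      by move: guv; rewrite leNgt nmulr_rgt0// gv.
    by move: guv; rewrite leNgt pmulr_rgt0// gv.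
  have : w \in `]a, b[.
    move: uab vab wuv; rewrite !in_itv/= => /andP[au ub] /andP[av vb] /andP[uw wv].
    by rewrite (lt_le_trans au uw) (le_lt_trans wv vb).
  by move=> /g0; rewrite gw eqxx.
have [mx|/ltW xm] := leP m x; first exact: (hcommon m x).
by apply: (hcommon x m) => //; rewrite mulrC.
Qed.

(** Induction on the increasing list of zeros, from the right: [t] keeps only the zeros where [g]
    changes sign, and [c] carries a global sign. *)
Lemma sign_polynomial g a b s : continuous g -> pairwise <%R s ->
  (forall z, z \in s -> (z \in `]a, b[) /\ g z = 0) ->
  (forall x, x \in `]a, b[ -> g x = 0 -> x \in s) ->
  exists t c, [/\ (size t <= size s)%N,
    (forall z, z \in t -> z \in `]a, b[%R), c != 0
    & forall x, x \in `]a, b[ -> 0 <= c * g x * \prod_(z <- t) (x - z)].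
Proof.
move=> cg; elim/last_ind: s b => [b _ _ g0|s z IH b].
  have [|c c0 cP] := @constant_sign g a b cg.
    by move=> x /g0 h; apply/eqP => /h.
  by exists [::], c; split=> // x xab; rewrite big_nil mulr1 ltW// cP.
rewrite pairwise_rcons => /andP[/allP sz ss] szP g0.
have [zab gz] : (z \in `]a, b[) /\ g z = 0 by apply: szP; rewrite mem_rcons inE eqxx.
move: (zab); rewrite in_itv/= => /andP[az zb].
have [|x xaz gx|t [c [ts taz c0 cP]]] := IH z ss.
- move=> y ys; have [] := szP y; first by rewrite mem_rcons inE ys orbT.
  rewrite !in_itv/= => /andP[ay yb] gy; split=> //.
  by rewrite ay; exact: sz.
- have [xa xz] : a < x /\ x < z by move: xaz; rewrite in_itv/= => /andP[].
  have := g0 x; rewrite in_itv/= xa (lt_trans xz zb) mem_rcons inE => /(_ isT gx).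
  by rewrite lt_eqF.
have [x xzb|d d0 dP] := @constant_sign g z b cg.
  have [xz xb] : z < x /\ x < b by move: xzb; rewrite in_itv/= => /andP[].
  apply/eqP => /g0; rewrite in_itv/= (lt_trans az xz) xb mem_rcons inE => /(_ isT).
  rewrite gt_eqF//= => /sz; rewrite ltNge => /negP; apply; exact: ltW.
have tprod x : z < x -> 0 < \prod_(y <- t) (x - y).
  move=> zx; rewrite big_seq; apply: prodr_gt0 => y /taz.
  by rewrite in_itv/= subr_gt0 => /andP[_ yz]; exact: lt_trans zx.
have taz' y : y \in t -> y \in `]a, b[.
  move=> /taz; rewrite !in_itv/= => /andP[-> yz]; exact: lt_trans zb.
(* Right of [z] the product over [t] is positive, so [g] keeps its sign across [z] relative to that
   product exactly when [c] and [d] agree. Otherwise [z] joins [t], and [c] is negated because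
   [x - z] is negative on the left. *)
have [cd|cd] : 0 < c * d \/ c * d < 0.
  by have := mulf_neq0 c0 d0; rewrite neq_lt => /orP[|]; [right|left].
- exists t, c; split=> //; first by rewrite size_rcons (leq_trans ts).
  move=> x; rewrite in_itv/= => /andP[ax xb]; have [xz|zx|->] := ltgtP x z.
  + by apply: cP; rewrite in_itv/= ax.
  + have := dP x; rewrite in_itv/= zx xb => /(_ isT) dg; have := tprod x zx.
    move=> /ltW p0; apply: mulr_ge0 => //; nra.
  + by rewrite gz mulr0 mul0r.
- exists (z :: t), (- c); split.
  + by rewrite size_rcons.
  + by move=> y; rewrite inE => /predU1P[->|/taz'].
  + by rewrite oppr_eq0.
  move=> x; rewrite in_itv/= => /andP[ax xb]; rewrite big_cons.
  have [xz|zx|->] := ltgtP x z.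
  + have : 0 <= c * g x * \prod_(y <- t) (x - y) by apply: cP; rewrite in_itv/= ax.
    by move: (\prod_(y <- t) (x - y)) => p; nra.
  + have := dP x; rewrite in_itv/= zx xb => /(_ isT) dg; have := tprod x zx.
    move=> /ltW p0; rewrite mulrA; apply: mulr_ge0 => //.
    by apply: mulr_ge0; [nra|rewrite subr_ge0 ltW].
  + by rewrite gz mulr0 mul0r.
Qed.

End continuous_on_unit_interval.

Section L1_best_approximation_uniqueness.
Variable R : realType.
Implicit Types (g q : R -> R) (s t : seq R).
Local Notation leb := (@lebesgue_measure R).

(** Here [|x - z| < 1], and on that range [sin (pi * y)] has the sign of [y]. *)
Lemma sin_prod_sign t x : x \in `]0, 1[ -> (forall z, z \in t -> z \in `[0, 1[) ->
  exists2 c, 0 < c & \prod_(z <- t) sin (pi * (x - z)) = c * \prod_(z <- t) (x - z).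
Proof.
rewrite in_itv/= => /andP[x0 x1]; elim: t => [_|z t IH tP].
  by exists 1; rewrite // !big_nil mulr1.
have [|c c0 cE] := IH; first by move=> y yt; apply: tP; rewrite inE yt orbT.
have : z \in `[0, 1[ by apply: tP; rewrite inE eqxx.
rewrite in_itv/= => /andP[z0 z1].
have [d d0 dE] : exists2 d, 0 < d & sin (pi * (x - z)) = d * (x - z).
  have sinpos (y : R) : 0 < y < 1 -> 0 < sin (pi * y).
    move=> /andP[y0 y1]; apply: sin_gt0_pi.
    by rewrite mulr_gt0 ?pi_gt0// gtr_pMr ?pi_gt0.
  have [xz|zx|->] := ltgtP x z; last by exists 1; rewrite // subrr !mulr0 sin0.
    exists (sin (pi * (x - z)) / (x - z)).
      rewrite -opprB mulrN sinN invrN mulrNN divr_gt0 ?subr_gt0//.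
      by apply: sinpos; lra.
    by rewrite divfK// subr_eq0 lt_eqF.
  exists (sin (pi * (x - z)) / (x - z)).
    by rewrite divr_gt0 ?subr_gt0//; apply: sinpos; lra.
  by rewrite divfK// subr_eq0 gt_eqF.
exists (d * c); first exact: mulr_gt0.
by rewrite !big_cons dE cE mulrACA.
Qed.

Lemma continuous_prod (h : R -> R -> R) t : (forall z, continuous (h z)) ->
  continuous (fun x => \prod_(z <- t) h z x).
Proof.
move=> ch; elim: t => [|z t IH].
  by under eq_fun do rewrite big_nil; move=> x; exact: cvg_cst.
by under eq_fun do rewrite big_cons; exact: fctM_continuous.
Qed.

(** Replaces the factors of [sign_polynomial] by sines and makes their number even, so that
    [sin_prod_is_trigpoly] applies to the product. *)
Lemma periodic_sign g s : continuous g -> g 0 = g 1 ->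
  (forall x, x \in `[0, 1[ -> g x = 0 -> x \in s) ->
  exists t c, [/\ (size t <= size s)%N && ~~ odd (size t),
    (forall z, z \in t -> z \in `[0, 1[), c != 0
    & forall x, x \in `[0, 1] -> 0 <= c * g x * \prod_(z <- t) sin (pi * (x - z))].
Proof.
move=> cg g01 sP.
(* [s] may contain 0 and points that are not zeros of [g]; [s0] keeps exactly the zeros in the open
   interval. *)
pose s0 := undup [seq z <- s | (z \in `]0, 1[) && (g z == 0)].
have s0P z : z \in s0 = [&& z \in s, z \in `]0, 1[ & g z == 0].
  by rewrite mem_undup mem_filter andbC.
have [||| t [c [ts t01 c0 cP]]] := @sign_polynomial R g 0 1 (sort <=%R s0) cg.
- have : sorted <%R (sort <=%R s0) by rewrite sort_lt_sorted undup_uniq.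
  by rewrite sorted_pairwise//; exact: lt_trans.
- by move=> z; rewrite mem_sort s0P => /and3P[_ -> /eqP].
- move=> x x01 gx; rewrite mem_sort s0P x01 gx eqxx andbT/= sP//.
  by move: x01; rewrite !in_itv/= => /andP[/ltW -> ->].
have t01' z : z \in t -> z \in `[0, 1[.
  by move=> /t01; rewrite !in_itv/= => /andP[/ltW -> ->].
rewrite size_sort in ts.
have cid_sub z : continuous (fun x : R => x - z).
  by apply: fctB_continuous => x; [exact: cvg_id|exact: cvg_cst].
have csin t' : continuous (fun x => \prod_(z <- t') sin (pi * (x - z)) : R).
  apply: continuous_prod => z x; apply: continuous_comp; last exact: continuous_sin.
  exact: fctZ_continuous.
have s0s : (size s0 <= size s)%N.
  by rewrite (leq_trans (size_undup _))// size_filter count_size.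
have [tev|todd] := boolP (~~ odd (size t)).
  exists t, c; split=> //; first by rewrite tev (leq_trans ts).
  apply: continuous_ge0_closure.
    by apply: fctM_continuous => //; exact: fctZ_continuous.
  move=> x x01; have [d d0 ->] := sin_prod_sign x01 t01'.
  by rewrite mulrCA mulr_ge0 ?(ltW d0)//; exact: cP.
have cf0 := @continuous_ge0_closure R (fun x => c * g x * \prod_(z <- t) (x - z))
  (fctM_continuous (@fctZ_continuous R c _ cg) (continuous_prod cid_sub)) cP.
(* An odd number of sign changes in ]0, 1[ forces a zero at the point 0 of the circle,
   which restores the parity without changing the sign inside. *)
have g0 : g 0 = 0.
  (* The product is positive at 1 and, [t] having odd size, negative at 0. As [g 0 = g 1], the
     number [c * g 0] is both nonnegative and nonpositive. *)
  have p1 : 0 < \prod_(z <- t) (1 - z).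
    rewrite big_seq; apply: prodr_gt0 => z /t01.
    by rewrite in_itv/= subr_gt0 => /andP[].
  have p0 : \prod_(z <- t) (0 - z) < 0.
    have -> : \prod_(z <- t) (0 - z) = (-1) ^+ size t * \prod_(z <- t) z.
      elim: (t) => [|z u IH]; first by rewrite !big_nil mulr1.
      by rewrite !big_cons IH/= exprS; ring.
    rewrite -signr_odd (negbNE todd) expr1 mulN1r oppr_lt0 big_seq.
    by apply: prodr_gt0 => z /t01; rewrite in_itv/= => /andP[].
  have := cf0 0; rewrite in_itv/= lexx ler01 => /(_ isT).
  rewrite nmulr_lge0// => cg0.
  have := cf0 1; rewrite in_itv/= lexx ler01 => /(_ isT).
  rewrite pmulr_lge0// -g01 => cg0'.
  have /eqP : c * g 0 = 0 by apply/eqP; rewrite eq_le cg0.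
  by rewrite mulf_eq0 (negbTE c0)/= => /eqP.
exists (0 :: t), c; split=> //.
(* The size bound survives the extra point: 0 is a zero of [g], hence in [s], but it is not in
   [s0]. *)
- rewrite /= negbK (negbNE todd) andbT (leq_ltn_trans ts)//.
  apply: (@leq_trans (size (0 :: s0))) => //; apply: uniq_leq_size.
    by rewrite /= undup_uniq andbT s0P in_itv/= ltxx/= andbF.
  move=> z; rewrite inE => /predU1P[->|]; last by rewrite s0P => /and3P[].
  by apply: sP => //; rewrite in_itv/= lexx ltr01.
- by move=> z; rewrite inE => /predU1P[->|/t01'//]; rewrite in_itv/= lexx ltr01.
apply: continuous_ge0_closure.
  by apply: fctM_continuous => //; exact: fctZ_continuous.
move=> x x01; have [d d0 E] := sin_prod_sign x01 t01'.
have px : 0 < sin (pi * x).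
  apply: sin_gt0_pi; move: x01; rewrite in_itv/= => /andP[x0 x1].
  by rewrite mulr_gt0 ?pi_gt0// gtr_pMr ?pi_gt0.
rewrite big_cons subr0 E mulrCA mulr_ge0 ?(ltW px)// mulrCA mulr_ge0 ?(ltW d0)//.
exact: cP.
Qed.

(* Moving [g] towards a [q] of the same sign lowers the L1 norm; since
   [|a| - |a - e b| = 2 min(|a|, e |b|) - e |b|] when [a b >= 0], minimality bounds
   the integral of [min(|g| / e, |q|)], which increases to [|q|] as [e] decreases. *)
Lemma L1_descent g q s : continuous g -> continuous q ->
  (forall x, x \in `[0, 1[ -> g x = 0 -> x \in s) ->
  (forall x, x \in `[0, 1] -> 0 <= g x * q x) ->
  (forall e, 0 < e -> int01 (fun x => `|g x|) <= int01 (fun x => `|g x - e * q x|)) ->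
  forall x, x \in `[0, 1] -> q x = 0.
Proof.
move=> cg cq sP gq gmin.
have cng := fct_norm_continuous cg; have cnq := fct_norm_continuous cq.
pose f (m : nat) x := Num.min (m.+1%:R * `|g x|) `|q x|.
have cf m : continuous (f m).
  move=> x; apply: (@continuous_min _ _ (fun x => m.+1%:R * `|g x|) (fun x => `|q x|)).
    exact: fctZ_continuous.
  exact: cnq.
have If m : int01 (f m) <= 2^-1 * int01 (fun x => `|q x|).
  pose e : R := m.+1%:R^-1.
  have e0 : 0 < e by rewrite invr_gt0 ltr0n.
  have ce : continuous (fun x => e * f m x) := @fctZ_continuous _ e _ (cf m).
  have ceq := @fctZ_continuous _ e _ cq; have cenq := @fctZ_continuous _ e _ cnq.
  have E x : x \in `[0, 1] ->
      `|g x - e * q x| = `|g x| - (2 * (e * f m x) - e * `|q x|).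
    move=> /gq gqx; rewrite /f minr_pMr ?(ltW e0)// /e mulKf ?pnatr_eq0// -/e.
    have -> : `|g x - e * q x| = `| `|g x| - e * `|q x| |.
      have [g0|g0|g0] := ltgtP (g x) 0.
      - have q0 : q x <= 0 by rewrite -(nmulr_rge0 _ g0).
        by rewrite (ltr0_norm g0) (ler0_norm q0) -normrN; congr `|_|; ring.
      - have q0 : 0 <= q x by rewrite -(pmulr_rge0 _ g0).
        by rewrite (gtr0_norm g0) (ger0_norm q0).
      - by rewrite g0 normr0 !sub0r !normrN !normrM normr_id.
    case: (leP `|g x| (e * `|q x|)) => h.
      by rewrite ler0_norm ?subr_le0//; ring.
    by rewrite gtr0_norm ?subr_gt0//; ring.
  have := gmin e e0; rewrite [X in _ <= X](_ : _ =
      int01 (fun x => `|g x| - (2 * (e * f m x) - e * `|q x|))); last first.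
    by apply: eq_Rintegral => x; rewrite inE; exact: E.
  rewrite int01B//; last exact/fctB_continuous/cenq/fctZ_continuous.
  rewrite int01B//; last exact: fctZ_continuous.
  rewrite !int01Z// lerDl oppr_ge0 subr_le0 mulrCA ler_pM2l// => h.
  by rewrite ler_pdivlMl.
pose I : set (measurableTypeR R) := `[0, 1]%classic.
have Ilim : (\int[leb]_(x in I) (f m x)%:E)%E @[m --> \oo] -->
    (\int[leb]_(x in I) `|q x|%:E)%E.
  have mE (h : R -> R) (ch : continuous h) :=
    measurable_int leb (continuous_integrable_itv 0 1 ch).
  have fq m x : (`|(f m x)%:E| <= `|q x|%:E)%E.
    by rewrite lee_fin ger0_norm ?ge_min ?lexx ?orbT// le_min mulr_ge0//= normr_ge0.
  (* Where [g x] is nonzero, the sequence is eventually equal to [|q x|]. The exceptions lie in [s],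
     which covers [[0, 1[], or at the endpoint 1. *)
  have ae_lim : {ae leb, forall x, I x ->
      (fun m => (f m x)%:E) @ \oo --> `|q x|%:E}.
    exists [set` 1 :: s]; split.
    + by apply: countable_measurable => //; exact/finite_set_countable/finite_seq.
    + by apply: countable_lebesgue_measure0; exact/finite_set_countable/finite_seq.
    + move=> x /= /not_implyP[]; rewrite /I/= in_itv/= => /andP[x0 x1] nlim.
      rewrite in_cons -implyNb; apply/implyP => xn1; apply: sP.
        by rewrite in_itv/= x0 lt_neqAle xn1.
      apply: contra_notP nlim => /eqP gx0; apply: cvg_near_cst.
      have ng : 0 < `|g x| by rewrite normr_gt0.
      exists (Num.trunc (`|q x| / `|g x|)) => // m /= hm.
      congr _%:E; apply/min_idPr; rewrite -ler_pdivrMr//.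
      rewrite (le_trans (ltW (truncnS_gt _)))// ler_nat.
      by rewrite ltnS.
  have [_ _] := @dominated_convergence _ _ R leb I (measurable_itv _)
    (fun m x => (f m x)%:E) _ _ (fun m => mE _ (cf m))
    (mE _ cnq) ae_lim (continuous_integrable_itv 0 1 cnq)
    (aeW leb (fun x m _ => fq m x)).
  exact.
(* In the limit, the L1 norm of [q] is at most half of itself. *)
have Iq : int01 (fun x => `|q x|) <= 2^-1 * int01 (fun x => `|q x|).
  have fin (h : R -> R) : continuous h ->
      (\int[leb]_(x in I) (h x)%:E = (int01 h)%:E)%E.
    move=> ch; rewrite fineK//.
    by apply: integrable_fin_num => //; exact: continuous_integrable_itv.
  rewrite -lee_fin -[X in (X <= _)%E]fin//; apply: (cvge_le _ Ilim).
  by apply: nearW => m; rewrite fin// lee_fin.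
have q0 : int01 (fun x => `|q x|) = 0.
  by apply/eqP; rewrite eq_le Rintegral_ge0// andbT; lra.
by move=> x x01; apply: normr0_eq0; apply: int01_eq0 q0 _ x01.
Qed.

End L1_best_approximation_uniqueness.

(** * Jackson's uniqueness argument *)

Section L1_jackson.
Variables (R : realType) (n : nat) (G : R -> R).
Hypotheses (cG : continuous G) (G01 : G 0 = G 1).
Implicit Types S T : R -> R.

Lemma continuous_is_trigpoly S : is_trigpoly n S -> continuous S.
Proof. by move=> /is_trigpoly_trig[a [b ->]]; exact: continuous_trig. Qed.

Lemma is_trigpoly_period S : is_trigpoly n S -> S 1 = S 0.
Proof. by move=> /is_trigpoly_trig[a [b ->]]; exact: trig_period. Qed.

Lemma exists_notin_unit_interval (s : seq R) :
  exists2 x, x \in `]0, 1[ & x \notin s.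
Proof.
apply/not_exists2P => h.
have : countable (`]0, 1[%classic : set R).
  apply: (@sub_countable _ _ _ [set` s]).
    apply: subset_card_le => x /= x01; have [//|/negP] := h x.
    by rewrite negbK.
  exact/finite_set_countable/finite_seq.
move=> /countable_lebesgue_measure0; rewrite lebesgue_measure_itv/= lte_fin ltr01.
by rewrite oppr0 adde0 => -[] /eqP; rewrite oner_eq0.
Qed.

Let Phi S := int01 (fun x => `|G x - S x|).

Lemma L1_best_approx_unique S T : is_trigpoly n S -> is_trigpoly n T ->
  (forall U, is_trigpoly n U -> Phi S <= Phi U) ->
  (forall U, is_trigpoly n U -> Phi T <= Phi U) -> S = T.
Proof.
move=> tS tT minS minT; apply/funext => y; apply/eqP; rewrite -subr_eq0.
apply/negPn/negP => STy.
have cS := continuous_is_trigpoly tS; have cT := continuous_is_trigpoly tT.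
pose U x := 2^-1 * S x + 2^-1 * T x.
have tU : is_trigpoly n U := is_trigpoly_lin _ _ tS tT.
have cU := continuous_is_trigpoly tU.
pose g x := G x - U x.
have cg : continuous g by exact: fctB_continuous.
have cGS := fct_absB_continuous cG cS; have cGT := fct_absB_continuous cG cT.
have cng := fct_norm_continuous cg.
(* This function is nonnegative, since [2 * g] is the sum of the two errors, and its integral is at
   most 0, since [S] and [T] do at least as well as [U]. Continuity then gives equality at every
   point. *)
have gE x : x \in `[0, 1] -> `|G x - S x| + `|G x - T x| - 2 * `|g x| = 0.
  have gE2 z : 2 * `|g z| = `|(G z - S z) + (G z - T z)|.
    rewrite -[X in X * _](@ger0_norm _ 2)// -normrM; congr `|_|.
    by rewrite /g /U; field.
  apply: (@int01_eq0 _ (fun x => `|G x - S x| + `|G x - T x| - 2 * `|g x|)).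
  - by apply: fctB_continuous; [exact: fctD_continuous|exact: fctZ_continuous].
  - by move=> z _; rewrite gE2 subr_ge0 ler_normD.
  - apply/eqP; rewrite eq_le; apply/andP; split.
      rewrite int01B; [|exact: fctD_continuous|exact: fctZ_continuous].
      rewrite int01D// int01Z// subr_le0 mulrC mulr_natr mulr2n.
      by rewrite lerD//; [exact: minS|exact: minT].
    by apply: Rintegral_ge0 => z _; rewrite gE2 subr_ge0 ler_normD.
have tST : is_trigpoly n (fun x => 1 * S x + -1 * T x) := is_trigpoly_lin _ _ tS tT.
have [|s [sn sP]] := trigpoly_zeros tST.
  by exists y; rewrite mul1r mulN1r.
have gs x : x \in `[0, 1[ -> g x = 0 -> x \in s.
  move=> x01 gx; apply: sP => //.
  have := gE x; rewrite gx normr0 mulr0 subr0 => /(_ _)/eqP.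
  rewrite paddr_eq0// !normr_eq0 !subr_eq0 => h.
  have /h/andP[/eqP <- /eqP <-] : x \in `[0, 1].
    by move: x01; rewrite !in_itv/= => /andP[-> /ltW].
  by rewrite mul1r mulN1r subrr.
have g01 : g 0 = g 1 by rewrite /g G01 (is_trigpoly_period tU).
have [t [c [/andP[ts et] t01 c0 cP]]] := periodic_sign cg g01 gs.
pose Q x := \prod_(z <- t) sin (pi * (x - z)).
have tQ : is_trigpoly n Q by apply: sin_prod_is_trigpoly => //; exact: leq_trans sn.
have cQ := continuous_is_trigpoly tQ.
have Q0 : forall x, x \in `[0, 1] -> c * Q x = 0.
  apply: (@L1_descent _ g (fun x => c * Q x) s) => //.
  - exact: fctZ_continuous.
  - by move=> x x01; rewrite mulrCA mulrA; exact: cP.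
  (* By [gE] the midpoint [U] is optimal as well, and [g - e * (c * Q)] is the error of the
     competitor [U + (e * c) * Q]. *)
  - move=> e e0; apply: (@le_trans _ _ (Phi S)).
      have : 2 * int01 (fun x => `|g x|) = Phi S + Phi T.
        rewrite -int01Z// -int01D//; apply: eq_Rintegral => x; rewrite inE => x01.
        by apply/esym/eqP; rewrite -subr_eq0; apply/eqP; exact: gE.
      have := minT S tS; lra.
    have tV : is_trigpoly n (fun x => 1 * U x + (e * c) * Q x) :=
      is_trigpoly_lin _ _ tU tQ.
    apply: (le_trans (minS _ tV)); rewrite le_eqVlt; apply/orP; left; apply/eqP.
    by apply: eq_Rintegral => x _; congr `|_|; rewrite /g; ring.
(* Inside []0, 1[], [Q] vanishes only at the points of [t], so it cannot be identically 0. *)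
have [x x01 xt] := exists_notin_unit_interval t.
have [d d0 QE] := sin_prod_sign x01 t01.
have := Q0 x; rewrite /Q QE => /(_ _)/eqP; rewrite !mulf_eq0 (negbTE c0) (gt_eqF d0)/=.
rewrite prodf_seq_eq0 => h.
have /h/hasP[z zt] : x \in `[0, 1].
  by move: x01; rewrite !in_itv/= => /andP[/ltW -> /ltW ->].
by rewrite subr_eq0 => /eqP xz; move: xt; rewrite xz zt.
Qed.

End L1_jackson.

(** * The Wasserstein distance on the circle *)

Section lip1_functions.
Variable R : realType.
Implicit Types f : R -> R.

Lemma tdist_le (x y : R) (k : int) : tdist x y <= `|x - y + k%:~R|.
Proof.
apply: ge_inf; last by exists k.
by exists 0 => _ [j _ <-].
Qed.

Lemma tdist_le_norm (x y : R) : tdist x y <= `|x - y|.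
Proof. by have := tdist_le x y 0; rewrite addr0. Qed.

(** A shift by [k <> 0] leaves at least [|k| - |x - y|], hence at least [1 - |x - y|]. *)
Lemma le_tdist (x y r : R) : `|x - y| <= 1 -> r <= `|x - y| -> r <= 1 - `|x - y| ->
  r <= tdist x y.
Proof.
move=> d1 rd rd1; apply: lb_le_inf; first by exists `|x - y + 0%:~R|, 0.
move=> _ [k _ <-]; have [->|k0] := eqVneq k 0; first by rewrite addr0.
apply: (le_trans rd1); rewrite [x - y + _]addrC.
have := lerB_dist (k%:~R : R) (- (x - y)); rewrite opprK normrN.
move/(le_trans _); apply; rewrite lerD2r -intr_norm ler1z.
by move: k0; rewrite -normr_gt0; lia.
Qed.

Lemma lip1_cst (c : R) : lip1 (fun=> c).
Proof.
move=> x y _ _; rewrite subrr normr0; apply: lb_le_inf.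
  by exists `|x - y + 0%:~R|, 0.
by move=> _ [k _ <-].
Qed.

Lemma torus_lip f x y : lip1 f -> torus R x -> torus R y -> `|f x - f y| <= `|x - y|.
Proof. by move=> lf tx ty; rewrite (le_trans (lf _ _ tx ty))// tdist_le_norm. Qed.

Lemma lip1_within_continuous f : lip1 f -> {within torus R, continuous f}.
Proof.
move=> lf; apply/subspace_continuousP => x Tx; apply/cvgrPdist_lt => e e0.
apply/nbhs_normP; exists e => //= y xy Ty.
by rewrite (le_lt_trans (torus_lip lf Tx Ty)).
Qed.

End lip1_functions.

(** * Integration against measures and charges on a grid *)

Section step_approximation.
Variables (R : realType) (m : {finite_measure set (measurableTypeR R) -> \bar R}).
Variable f : R -> R.
Hypothesis lf : lip1 f.

Lemma torus0 : torus R 0.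
Proof. by rewrite /torus/= in_itv/= lexx ltr01. Qed.

Lemma lip1_integrable (A : set (measurableTypeR R)) : measurable A ->
  A `<=` torus R -> m.-integrable A (EFin \o f).
Proof.
move=> mA AT.
have mT : measurable (torus R : set (measurableTypeR R)).
  exact: measurable_itv.
apply: integrableS mA AT _ => //.
apply: measurable_bounded_integrable => //.
- by rewrite -ge0_fin_numE// fin_num_measure//; exact: measurable_itv.
- apply: subspace_continuous_measurable_fun => //.
  exact: lip1_within_continuous.
- exists (`|f 0| + 1); split; first exact: num_real.
  move=> M fM x Tx /=; apply/ltW/(le_lt_trans _ fM).
  rewrite -[f x](subrK (f 0)) addrC (le_trans (ler_normD _ _))//.
  rewrite lerD2l (le_trans (torus_lip lf Tx torus0))// subr0.
  by move: Tx; rewrite /torus/= in_itv/= => /andP[x0 x1]; rewrite ger0_norm// ltW.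
Qed.

Definition distr_fun (t : R) : R := fine (m `[0, t[%classic).

Lemma cdf_itv a b : 0 <= a -> a <= b ->
  fine (m `[a, b[%classic) = distr_fun b - distr_fun a.
Proof.
move=> a0 ab; rewrite /distr_fun (@itv_bndbnd_setU _ _ (BLeft 0) (BLeft a) (BLeft b))//.
rewrite measureU//=; last first.
  apply/seteqP; split=> // x [/=]; rewrite !in_itv/= => /andP[_ xa] /andP[ax _].
  by move: xa; rewrite ltNge ax.
by rewrite fineD ?fin_num_measure//; ring.
Qed.

Lemma cdf_step a b : 0 <= a -> a <= b -> b <= 1 ->
  `|\int[m]_(x in `[a, b[) f x - f a * (distr_fun b - distr_fun a)|
  <= (b - a) * (distr_fun b - distr_fun a).
Proof.
move=> a0 ab b1; have mA : measurable (`[a, b[%classic : set (measurableTypeR R)).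
  exact: measurable_itv.
have [<-|{}ab] : a = b \/ a < b by move: ab; rewrite le_eqVlt => /predU1P.
  rewrite set_itv_ge ?bnd_simp ?ltxx// Rintegral_set0.
  by rewrite !subrr mulr0 subrr normr0 mul0r.
have AT : `[a, b[ `<=` torus R.
  move=> x; rewrite /torus/= !in_itv/= => /andP[ax xb].
  by rewrite (le_trans a0 ax) (lt_le_trans xb b1).
have Ta : torus R a by rewrite /torus/= in_itv/= a0 (lt_le_trans ab).
have intf := lip1_integrable mA AT.
have intc c : m.-integrable `[a, b[ (EFin \o (fun=> c)).
  exact: finite_measure_integrable_cst.
rewrite -(cdf_itv a0 (ltW ab)) -[f a * _]Rintegral_cst// -RintegralB//.
apply: (le_trans (le_normr_Rintegral mA _)).
  by have := integrableB mA intf (intc (f a)).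
rewrite -Rintegral_cst//; apply: le_Rintegral => //.
  by have := integrable_abse (integrableB mA intf (intc (f a))).
move=> x xab; rewrite (le_trans (torus_lip lf (AT _ xab) Ta))//.
by move: xab; rewrite /= in_itv/= => /andP[ax xb]; rewrite ger0_norm; lra.
Qed.

(** On a cell, [f] differs from its value at the left end by at most 1/N; these errors, weighted by
    the masses of the cells, add up. Left ends stay in the torus, unlike the right end 1. *)
Lemma step_approx (N k : nat) : (k <= N)%N -> (0 < N)%N ->
  `|\int[m]_(x in `[0, k%:R / N%:R[) f x
    - \sum_(j < k) f (j%:R / N%:R) *
        (distr_fun (j.+1%:R / N%:R) - distr_fun (j%:R / N%:R))|
  <= N%:R^-1 * distr_fun (k%:R / N%:R).
Proof.
move=> + N0; have N0' : 0 < N%:R :> R by rewrite ltr0n.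
elim: k => [_|k IH kN].
  rewrite mul0r set_itv_ge ?bnd_simp ?ltxx// Rintegral_set0 big_ord0 subrr normr0.
  by rewrite mulr_ge0 ?invr_ge0 ?ler0n// fine_ge0.
pose a : R := k%:R / N%:R; set b := k.+1%:R / N%:R.
have a0 : 0 <= a by rewrite divr_ge0.
have abE : b = a + N%:R^-1 by rewrite /b -natr1 mulrDl mul1r.
have ab : a <= b by rewrite abE lerDl invr_ge0 ler0n.
have b1 : b <= 1 by rewrite ler_pdivrMr// mul1r ler_nat.
rewrite (@itv_bndbnd_setU _ _ (BLeft 0) (BLeft a) (BLeft b)) ?bnd_simp//.
rewrite Rintegral_setU//; last 2 first.
- apply: lip1_integrable; first by apply: measurableU.
  by move=> x /= []; rewrite /torus/= !in_itv/= => /andP[x0 x1]; apply/andP; split; lra.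
- apply/disj_setPS => x [/=]; rewrite !in_itv/= => /andP[_ xa] /andP[ax _].
  by move: xa; rewrite ltNge ax.
rewrite big_ord_recr/= -/a -/b opprD addrACA.
apply: (le_trans (ler_normD _ _)).
have -> : N%:R^-1 * distr_fun b =
    N%:R^-1 * distr_fun a + (b - a) * (distr_fun b - distr_fun a).
  by rewrite abE; ring.
by apply: lerD; [exact/IH/ltnW|exact: cdf_step].
Qed.

End step_approximation.

Section charge_integrals.
Variables (R : realType) (eta : {charge set (measurableTypeR R) -> \bar R}).
Variable H : R -> R.
Hypothesis HE : forall t, 0 <= t <= 1 -> eta `[0, t[%classic = (H t)%:E.
Hypothesis H1 : H 1 = 0.

(* Abel summation; [f 1 = f 0] because [1] stands for the point [0] of the circle. *)
Lemma charge_integral_abel : exists V : R, forall f, lip1 f -> f 1 = f 0 ->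
  exists2 I : R, charge_integral eta f = I%:E & forall N c, (0 < N)%N ->
  `|I + \sum_(k < N) (f (k.+1%:R / N%:R) - f (k%:R / N%:R)) * (H (k.+1%:R / N%:R) - c)|
    <= N%:R^-1 * V.
Proof.
pose h := svalP (cid (hahn_exists eta)).
pose mp : {finite_measure set (measurableTypeR R) -> \bar R} := jordan_pos h.
pose mn : {finite_measure set (measurableTypeR R) -> \bar R} := jordan_neg h.
(* The total variation of [eta] on the torus, a bound independent of [f], [N] and [c]. *)
exists (distr_fun mp 1 + distr_fun mn 1) => f lf f1.
exists (\int[mp]_(x in torus R) f x - \int[mn]_(x in torus R) f x).
  have mT : measurable (torus R : set (measurableTypeR R)) by exact: measurable_itv.
  rewrite /charge_integral EFinB /Rintegral !fineK//.
    by apply: integrable_fin_num => //; apply: lip1_integrable.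
  by apply: integrable_fin_num => //; apply: lip1_integrable.
move=> N c N0; have N0' : N%:R != 0 :> R by rewrite pnatr_eq0 -lt0n.
have HE' t : 0 <= t <= 1 -> H t = distr_fun mp t - distr_fun mn t.
  move=> t01; have := HE t01; rewrite (jordan_decomp h)//.
  rewrite /cadd/= cscaleN1 => HE1; apply: EFin_inj.
  by rewrite -HE1 EFinB /distr_fun !fineK// fin_num_measure.
have ap := step_approx mp lf (leqnn N) N0; have an := step_approx mn lf (leqnn N) N0.
rewrite divff// in ap an.
pose x k : R := k%:R / N%:R.
have x01 (k : nat) : (k <= N)%N -> 0 <= x k <= 1.
  by move=> kN; rewrite divr_ge0//= ler_pdivrMr ?ltr0n// mul1r ler_nat.
have H0 : H 0 = 0.
  apply: EFin_inj; rewrite -HE ?lexx ?ler01// set_itv_ge ?bnd_simp ?ltxx//.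
  by rewrite charge0.
have -> : \sum_(k < N) (f (x k.+1) - f (x k)) * (H (x k.+1) - c) =
    \sum_(k < N) f (x k) * (distr_fun mn (x k.+1) - distr_fun mn (x k)) -
    \sum_(k < N) f (x k) * (distr_fun mp (x k.+1) - distr_fun mp (x k)).
  (* The boundary terms of the summation cancel for every [c], because [f 1 = f 0] and
     [H 1 = H 0 = 0]. *)
  pose F k := f (x k) * (H (x k) - c).
  have F0 : \sum_(k < N) (F k.+1 - F k) = 0.
    rewrite -(big_mkord xpredT (fun k => F k.+1 - F k)) telescope_sumr//.
    by rewrite /F /x divff// mul0r f1 H1 H0 subrr.
  rewrite -[RHS](addr0 _) -[X in _ = _ + X]F0 -sumrB -big_split/=.
  apply: eq_bigr => k _.
  by rewrite /F !HE' ?x01 ?(ltnW (ltn_ord k))//; ring.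
rewrite mulrDr; apply: le_trans (lerD ap an); rewrite -/(torus R).
apply: le_trans (ler_normB _ _); rewrite le_eqVlt; apply/orP; left; apply/eqP.
by congr `|_|; rewrite /x /torus; ring.
Qed.

End charge_integrals.

Section distribution_functions.
Variable R : realType.
Implicit Types (H f u : R -> R).
Local Notation leb := (@lebesgue_measure R).

(** Composition with this retraction onto [[0, 1]] extends a function continuous there to one
    continuous on the whole line. *)
Definition clamp (x : R) : R := Num.max 0 (Num.min x 1).

Lemma clamp_itv x : clamp x \in `[0, 1].
Proof. by rewrite in_itv/= le_max lexx/= ge_max ler01 ge_min lexx orbT. Qed.

Lemma clamp_id x : x \in `[0, 1] -> clamp x = x.
Proof. by rewrite in_itv/= => /andP[x0 x1]; rewrite /clamp min_l// max_r. Qed.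

Lemma continuous_clamp : continuous clamp.
Proof.
move=> x; apply: (@continuous_max R R (fun=> 0 : R) (fun x => Num.min x 1)).
  exact: cvg_cst.
by apply: (@continuous_min R R id (fun=> 1 : R)); [exact: cvg_id|exact: cvg_cst].
Qed.

Lemma continuous_clamp_comp u : {within `[0, 1], continuous u} ->
  continuous (u \o clamp).
Proof.
move=> /subspace_continuousP uc x.
apply: (@cvg_comp _ _ _ _ _ _ (within `[0, 1] (nbhs (clamp x)))).
  move=> W /= WW.
  have WW' : nbhs (clamp x) [set y | y \in `[0, 1] -> W y] := WW.
  have : \forall y \near x, clamp y \in `[0, 1] -> W (clamp y).
    exact: (@continuous_clamp x _ WW').
  by apply: filterS => y; apply; exact: clamp_itv.
exact/uc/clamp_itv.
Qed.

(** The distribution function is the primitive of the Radon-Nikodym density, which is integrable, so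
    it is continuous on [[0, 1]]. *)
Lemma dominated_cdf (eta : {charge set (measurableTypeR R) -> \bar R}) :
  eta `<< leb -> exists2 H, continuous H &
    forall t, 0 <= t <= 1 -> eta `[0, t[%classic = (H t)%:E.
Proof.
move=> dom.
pose w : R -> R := fine \o Radon_Nikodym eta leb.
have wE : EFin \o w = Radon_Nikodym eta leb.
  by apply/funext => x; rewrite /w/= fineK// Radon_Nikodym_fin_num.
have iw : leb.-integrable setT (EFin \o w).
  by rewrite wE; exact: Radon_Nikodym_integrable.
have iwA (A : set (measurableTypeR R)) : measurable A -> leb.-integrable A (EFin \o w).
  by move=> mA; apply: integrableS iw.
exists ((fun t => \int[leb]_(x in `[0, t]) w x) \o clamp).
  by apply/continuous_clamp_comp/parameterized_integral_continuous => //; exact: iwA.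
move=> t t01; rewrite (Radon_Nikodym_integral dom)//= clamp_id ?in_itv//.
rewrite -Rintegral_itv_bndo_bndc; last exact: iwA.
rewrite -wE /Rintegral fineK//; apply: integrable_fin_num => //; exact: iwA.
Qed.

Lemma uniform_modulus H e : continuous H -> 0 < e -> exists2 N0 : nat, (0 < N0)%N &
  forall N, (N0 <= N)%N -> forall x y, x \in `[0, 1] -> `|x - y| <= N%:R^-1 ->
    `|H x - H y| <= e.
Proof.
move=> cH e0.
have cI : compact (`[0, 1]%classic : set R) := @segment_compact R 0 1.
pose P (N : nat) (x : R) := forall y, `|x - y| <= N%:R^-1 -> `|H x - H y| <= e.
have : \forall N \near \oo, (`[0, 1]%classic : set R) `<=` P N.
  move/compact_near_coveringP : cI; apply=> x _.
  have /cvgrPdist_lt/(_ (e / 2)) : H y @[y --> x] --> H x by exact: cH.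
  rewrite divr_gt0// => /(_ isT)/nbhs_normP[d /= d0 dP].
  (* Half of [d] allows for the move from [x] to [x'], the other half for the move from [x'] to
     [y]. *)
  exists (ball x (d / 2), [set N | (d / 2)^-1 < N%:R]).
    split; first by apply: nbhsx_ballx; rewrite divr_gt0.
    exact: nbhs_infty_gtr.
  move=> [x' N] /= []; rewrite -ball_normE/= => xx' dN y x'y.
  have Nd : N%:R^-1 < d / 2.
    have dp : 0 < (d / 2)^-1 by rewrite invr_gt0 divr_gt0.
    by rewrite -[d / 2]invrK ltf_pV2// posrE (lt_trans dp).
  have h1 : `|H x - H x'| < e / 2 by apply: dP => /=; lra.
  have h2 : `|H x - H y| < e / 2.
    apply: dP; rewrite /= -(subrKA x') (le_lt_trans (ler_normD _ _))//; lra.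
  by rewrite -(subrKA (H x)) (le_trans (ler_normD _ _))// distrC; lra.
case=> N0 _ N0P; exists N0.+1 => // N /ltnW N0N x y x01; exact: N0P.
Qed.

Lemma int01_split u (N : nat) : (0 < N)%N -> leb.-integrable `[0, 1] (EFin \o u) ->
  int01 u = \sum_(k < N) \int[leb]_(x in `]k%:R / N%:R, k.+1%:R / N%:R]) u x.
Proof.
move=> N0 iu; have N0' : 0 < N%:R :> R by rewrite ltr0n.
pose P k := \int[leb]_(x in `[0, k%:R / N%:R]) u x.
transitivity (P N - P 0).
  by rewrite /P divff ?gt_eqF// mul0r set_itv1 Rintegral_set1 subr0.
rewrite -telescope_sumr// big_mkord; apply: eq_bigr => k _.
rewrite /P Rintegral_itvB//.
- apply: integrableS iu => //; apply: subset_itvl.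
  by rewrite bnd_simp ler_pdivrMr// mul1r ler_nat.
- by rewrite bnd_simp divr_ge0.
- by rewrite bnd_simp ler_pM2r ?invr_gt0// ler_nat.
Qed.

Lemma Riemann_sum_le u e (N : nat) : (0 < N)%N -> continuous u ->
  (forall x y, x \in `[0, 1] -> `|x - y| <= N%:R^-1 -> `|u x - u y| <= e) ->
  \sum_(k < N) N%:R^-1 * `|u (k.+1%:R / N%:R)| <= int01 (fun x => `|u x|) + e.
Proof.
move=> N0 cu ue.
have N0' : 0 < N%:R :> R by rewrite ltr0n.
have cue : continuous (fun x => `|u x| + e).
  by apply: fctD_continuous; [exact: fct_norm_continuous|move=> x; exact: cvg_cst].
rewrite -[X in _ + X]int01_cst -int01D; last 2 first.
- exact: fct_norm_continuous.
- by move=> x; exact: cvg_cst.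
rewrite (int01_split N0); last exact: continuous_integrable_itv.
apply: ler_sum => k _; set a := k%:R / N%:R; set b := k.+1%:R / N%:R.
have abE : b = a + N%:R^-1 by rewrite /b -natr1 mulrDl mul1r.
have a0 : 0 <= a by rewrite divr_ge0.
have b1 : b <= 1 by rewrite ler_pdivrMr// mul1r ler_nat.
have ab : a < b by rewrite abE ltrDl invr_gt0.
have iab (h : R -> R) : continuous h -> leb.-integrable `]a, b] (EFin \o h).
  move=> ch; apply: integrableS (continuous_integrable_itv a b ch) => //.
  exact: subset_itv_oc_cc.
rewrite (_ : _ * _ = \int[leb]_(x in `]a, b]) `|u b|); last first.
  rewrite Rintegral_cst//= lebesgue_measure_itv/= lte_fin ab -EFinB/= mulrC.
  by congr (_ * _); rewrite abE; ring.
apply: le_Rintegral => //; [apply: iab => x; exact: cvg_cst|exact: iab|].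
move=> x /=; rewrite in_itv/= => /andP[ax xb].
have : `|u x - u b| <= e.
  apply: ue; first by rewrite in_itv/=; apply/andP; split; lra.
  by rewrite ler0_norm; lra.
by have := lerB_dist (u b) (u x); rewrite distrC; lra.
Qed.

End distribution_functions.

Section wasserstein_upper_bound.
Variables (R : realType) (eta : {charge set (measurableTypeR R) -> \bar R}).
Variable H : R -> R.
Hypotheses (cH : continuous H) (H1 : H 1 = 0).
Hypothesis HE : forall t, 0 <= t <= 1 -> eta `[0, t[%classic = (H t)%:E.

Lemma eq_charge_integral f g : (forall x, torus R x -> f x = g x) ->
  charge_integral eta f = charge_integral eta g.
Proof.
by move=> fg; rewrite /charge_integral; congr (_ - _)%E;
  apply: eq_integral => x; rewrite inE => /fg ->.
Qed.

Lemma natr_inv_small (V e : R) : 0 < e -> exists N0 : nat, forall N, (N0 <= N)%N ->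
  N%:R^-1 * V <= e.
Proof.
move=> e0; have [N0 _ N0P] := @nbhs_infty_gtr R (V / e).
exists (maxn 1 N0) => N; rewrite geq_max => /andP[N1 /N0P/= /ltW].
by rewrite ler_pdivrMr// mulrC ler_pdivrMl// ?ltr0n// mulrC.
Qed.

(** In the Abel sum, each increment of [f] is at most 1/N in absolute value, which leaves a Riemann
    sum of [|H - c|]. *)
Lemma charge_integral_le f c : lip1 f ->
  (`|charge_integral eta f| <= (int01 (fun x => `|H x - c|))%:E)%E.
Proof.
(* The point 1 is outside the torus, so [f 1] is arbitrary; it is reset to [f 0] without affecting
   the integral. *)
move=> lf; pose g x := if x == 1 then f 0 else f x.
have gT x : torus R x -> g x = f x.
  by rewrite /torus/= in_itv/= /g => /andP[_ x1]; rewrite lt_eqF.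
rewrite (@eq_charge_integral f g) => [|x /gT//].
have lg : lip1 g by move=> x y Tx Ty; rewrite !gT//; exact: lf.
have g1 : g 1 = g 0 by rewrite /g eqxx; case: eqP.
have [V /(_ g lg g1)[I IE VP]] := charge_integral_abel HE H1.
rewrite IE lee_fin; apply/ler_addgt0Pr => e e0.
have e20 : 0 < e / 2 by rewrite divr_gt0.
have cHc : continuous (fun x => H x - c).
  by apply: fctB_continuous => // x; exact: cvg_cst.
have [N0 N00 N0P] := uniform_modulus cHc e20.
have [N1 N1P] := natr_inv_small V e20.
pose N := maxn N0 N1; have NN0 : (0 < N)%N by rewrite (leq_trans N00) ?leq_maxl.
have NV : N%:R^-1 * V <= e / 2 by apply: N1P; rewrite leq_maxr.
have := Riemann_sum_le NN0 cHc (N0P N (leq_maxl _ _)).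
set S := \sum_(k < N) _ => S_le.
have N0' : 0 < N%:R :> R by rewrite ltr0n.
have := VP N c NN0; set A := \sum_(k < N) _ => IA.
suff AS : `|A| <= S.
  have -> : I = (I + A) - A by ring.
  by rewrite (le_trans (ler_normB _ _))//; lra.
apply: (le_trans (ler_norm_sum _ _ _)); apply: ler_sum => k _.
rewrite normrM ler_wpM2r//.
have Tk : torus R (k%:R / N%:R).
  by rewrite /torus/= in_itv/= divr_ge0//= ltr_pdivrMr// mul1r ltr_nat.
have dk : k.+1%:R / N%:R = k%:R / N%:R + N%:R^-1 :> R by rewrite -natr1 mulrDl mul1r.
have [kN|Nk] := ltnP k.+1 N.
  have Tk1 : torus R (k.+1%:R / N%:R).
    by rewrite /torus/= in_itv/= divr_ge0//= ltr_pdivrMr// mul1r ltr_nat.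
  by rewrite (le_trans (torus_lip lg Tk1 Tk))// dk addrAC subrr add0r ger0_norm.
(* The last cell ends at 1, where [g] takes its value at 0. Its increment is bounded through the
   wrap-around distance, with shift 1. *)
have kE : k.+1 = N by apply/eqP; rewrite eqn_leq Nk ltn_ord.
rewrite kE divff ?gt_eqF// g1 (le_trans (lg _ _ (torus0 R) Tk))//.
rewrite (le_trans (tdist_le _ _ 1))//.
have -> : k%:R / N%:R = 1 - N%:R^-1 :> R.
  by move: dk; rewrite kE divff ?gt_eqF// => dk; lra.
by rewrite sub0r opprB subrK ger0_norm.
Qed.

End wasserstein_upper_bound.

(** * Lower bound by explicit test functions *)

Section wasserstein_lower_bound.
Variables (R : realType) (eta : {charge set (measurableTypeR R) -> \bar R}).
Variable H : R -> R.
Hypotheses (cH : continuous H) (H1 : H 1 = 0).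
Hypothesis HE : forall t, 0 <= t <= 1 -> eta `[0, t[%classic = (H t)%:E.
Local Notation leb := (@lebesgue_measure R).
Implicit Types s : R -> R.

Lemma primitive_diff s a b : continuous s -> 0 <= a -> a <= b ->
  \int[leb]_(x in `[0, b]) s x - \int[leb]_(x in `[0, a]) s x
  = \int[leb]_(x in `]a, b]) s x.
Proof.
move=> cs a0 ab; rewrite Rintegral_itvB ?bnd_simp//.
exact: continuous_integrable_itv.
Qed.

Lemma continuous_integrable_itvoc s a b : continuous s ->
  leb.-integrable `]a, b] (EFin \o s).
Proof.
move=> cs; apply: integrableS (continuous_integrable_itv a b cs) => //.
exact: subset_itv_oc_cc.
Qed.

Lemma Rintegral_itvoc_bound s a b e : continuous s -> a <= b ->
  (forall x, a < x <= b -> `|s x| <= e) ->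
  `|\int[leb]_(x in `]a, b]) s x| <= e * (b - a).
Proof.
move=> cs ab se.
have [->|{}ab] : a = b \/ a < b by move: ab; rewrite le_eqVlt => /predU1P.
  by rewrite set_itv_ge ?bnd_simp ?ltxx// Rintegral_set0 subrr mulr0 normr0.
apply: (le_trans (le_normr_Rintegral _ (continuous_integrable_itvoc _ _ cs))) => //.
rewrite (_ : e * _ = \int[leb]_(x in `]a, b]) e); last first.
  by rewrite Rintegral_cst//= lebesgue_measure_itv/= lte_fin ab -EFinB.
apply: le_Rintegral => //.
- exact/continuous_integrable_itvoc/fct_norm_continuous.
- by apply: continuous_integrable_itvoc => x; exact: cvg_cst.
Qed.

(** An increment is an integral of [s] over the direct arc or, as [s] has mean 0, minus its integral
    over the complementary arc; [|s| <= 1] bounds it by both lengths. *)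
Lemma primitive_lip1 s : continuous s -> (forall x, `|s x| <= 1) -> int01 s = 0 ->
  lip1 (fun x => \int[leb]_(y in `[0, x]) s y).
Proof.
move=> cs s1 Is; set f := fun x => _.
have fxy x y : torus R x -> torus R y -> x <= y ->
    [/\ `|x - y| <= 1, `|f x - f y| <= `|x - y| & `|f x - f y| <= 1 - `|x - y|].
  rewrite /torus/= !in_itv/= => /andP[x0 x1] /andP[y0 y1] xy.
  have dE : `|x - y| = y - x by rewrite ler0_norm; lra.
  rewrite dE; split; first by lra.
    rewrite distrC /f primitive_diff// -[_ - _]mul1r.
    exact: Rintegral_itvoc_bound.
  have -> : f x - f y = (f x - f 0) + (f 1 - f y).
    by rewrite [f 0]/f set_itv1 Rintegral_set1 subr0 [f 1]Is sub0r.
  rewrite [f x - f 0](primitive_diff cs (lexx 0) x0).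
  rewrite [f 1 - f y](primitive_diff cs y0 (ltW y1)).
  apply: (le_trans (ler_normD _ _)).
  have := @Rintegral_itvoc_bound s 0 x 1 cs x0 (fun x _ => s1 x).
  have := @Rintegral_itvoc_bound s y 1 1 cs (ltW y1) (fun x _ => s1 x).
  rewrite !mul1r subr0 => by1 b0x; apply: (le_trans (lerD b0x by1)).
  by rewrite le_eqVlt; apply/orP; left; apply/eqP; ring.
move=> x y Tx Ty; have [xy|/ltW yx] := leP x y.
  by have [h1 h2 h3] := fxy x y Tx Ty xy; exact: le_tdist.
have [h1 h2 h3] := fxy y x Ty Tx yx.
by apply: le_tdist; rewrite ?(distrC x y) ?(distrC (f x)).
Qed.

(** Integration by parts, as the limit of the Abel sums with [c = 0]: on each cell, [H] is replaced
    by its value at the right end, at a total cost of at most [e / 2]. *)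
Lemma charge_integral_primitive s : continuous s -> (forall x, `|s x| <= 1) ->
  int01 s = 0 ->
  charge_integral eta (fun x => \int[leb]_(y in `[0, x]) s y)
  = (- int01 (fun x => s x * H x))%:E.
Proof.
move=> cs s1 Is; set f := fun x => _.
have f0 : f 0 = 0 by rewrite /f set_itv1 Rintegral_set1.
have f1 : f 1 = f 0 by rewrite f0.
have lf : lip1 f by exact: primitive_lip1.
have [V /(_ f lf f1)[I IE VP]] := charge_integral_abel HE H1.
rewrite IE; congr _%:E; apply/eqP.
rewrite -subr_eq0 opprK -normr_eq0 eq_le normr_ge0 andbT.
apply/ler_addgt0Pr => e e0; rewrite add0r.
have e20 : 0 < e / 2 by rewrite divr_gt0.
have [N0 N00 N0P] := uniform_modulus cH e20.
have [N1 N1P] := natr_inv_small V e20.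
pose N := maxn N0 N1; have NN0 : (0 < N)%N by rewrite (leq_trans N00) ?leq_maxl.
have NV : N%:R^-1 * V <= e / 2 by apply: N1P; rewrite leq_maxr.
have N0' : 0 < N%:R :> R by rewrite ltr0n.
have csH := fctM_continuous cs cH.
have := VP N 0 NN0; set A := \sum_(k < N) _ => IA.
suff AS : `|A - int01 (fun x => s x * H x)| <= e / 2.
  have -> : I + int01 (fun x => s x * H x) = (I + A) - (A - int01 (fun x => s x * H x)).
    by ring.
  by rewrite (le_trans (ler_normB _ _))// [leRHS]splitr lerD// (le_trans IA).
rewrite (int01_split NN0); last exact: continuous_integrable_itv.
rewrite -sumrB (le_trans (ler_norm_sum _ _ _))//.
have -> : e / 2 = \sum_(k < N) e / 2 * N%:R^-1.
  by rewrite sumr_const card_ord -[RHS]mulr_natr divfK ?gt_eqF.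
apply: ler_sum => k _; set a := k%:R / N%:R; set b := k.+1%:R / N%:R.
have abE : b = a + N%:R^-1 by rewrite /b -natr1 mulrDl mul1r.
have a0 : 0 <= a by rewrite divr_ge0.
have b1 : b <= 1 by rewrite ler_pdivrMr// mul1r ler_nat.
have ab : a <= b by rewrite abE lerDl invr_ge0.
rewrite /f primitive_diff// subr0.
rewrite -RintegralZr//; last exact: continuous_integrable_itvoc.
rewrite -RintegralB//; last 2 first.
- apply: (@continuous_integrable_itvoc (fun x => s x * H b)).
  by apply: fctM_continuous => // x; exact: cvg_cst.
- exact: (@continuous_integrable_itvoc (fun x => s x * H x)).
have -> : N%:R^-1 = b - a by rewrite abE; ring.
apply: (@Rintegral_itvoc_bound (fun x => s x * H b - s x * H x)) => //.
  by apply: fctB_continuous => //; apply: fctM_continuous => // x; exact: cvg_cst.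
move=> x /andP[ax xb]; rewrite -mulrBr normrM.
have : `|H x - H b| <= e / 2.
  apply: (N0P N (leq_maxl _ _)); first by rewrite in_itv/=; apply/andP; split; lra.
  by rewrite ler0_norm; lra.
rewrite distrC => Hb; apply: le_trans Hb; exact: ler_piMl.
Qed.

Lemma lipschitz_continuous (k : R) (f : R -> R) : 0 < k ->
  (forall x y, `|f x - f y| <= k * `|x - y|) -> continuous f.
Proof.
move=> k0 fk x; apply/cvgrPdist_lt => e e0; apply/nbhs_normP.
exists (k^-1 * e) => [|y /=]; first by rewrite /= mulr_gt0// invr_gt0.
by rewrite ltr_pdivlMl//; exact: le_lt_trans.
Qed.

Definition clip (y : R) : R := Num.max (-1) (Num.min y 1).

Lemma clipP y : [\/ y <= -1 /\ clip y = -1, -1 <= y <= 1 /\ clip y = y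
  | 1 <= y /\ clip y = 1].
Proof.
rewrite /clip; have [y1|/ltW y1] := leP y 1.
  have [y2|/ltW y2] := leP (-1) y; last by apply: Or31.
  by apply: Or32; split=> //; apply/andP.
by apply: Or33; split=> //; apply/max_idPr; lra.
Qed.

Lemma clip_lip y z : `|clip y - clip z| <= `|y - z|.
Proof.
wlog yz : y z / y <= z.
  by move=> h; case: (leP y z) => [|/ltW] /h //; rewrite distrC (distrC z).
rewrite ler0_norm; last first.
  by case: (clipP y) => -[hy ->]; case: (clipP z) => -[hz ->]; lra.
rewrite ler0_norm; last by lra.
by case: (clipP y) => -[hy ->]; case: (clipP z) => -[hz ->]; lra.
Qed.

Lemma clip_norm y : `|clip y| <= 1.
Proof. by case: (clipP y) => -[hy ->]; rewrite ler_norml; apply/andP; split; lra. Qed.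

(** Applied to [y = (H x - d) / e] and multiplied by [e], this says that smoothing the sign of
    [H x - d] loses at most [e]. *)
Lemma clip_mul y : `|y| - 1 <= clip y * y.
Proof.
case: (clipP y) => -[hy ->].
- by rewrite ler0_norm; lra.
- have : `|y| <= 1 by rewrite ler_norml.
  by rewrite -subr_le0 => h; rewrite (le_trans h)// -expr2 sqr_ge0.
- by rewrite ger0_norm; lra.
Qed.

(* The optimal [f] has [f' = sign (H - c)] with [c] a median of [H]; [clip] smooths
   the sign, and the intermediate value theorem provides the median. *)
Lemma charge_integral_ge : exists c, forall e, 0 < e ->
  exists2 f, lip1 f &
    ((int01 (fun x => `|H x - c|) - e)%:E <= `|charge_integral eta f|)%E.
Proof.
have [x0 _ HM] := EVT_max ler01 (continuous_subspaceT (fct_norm_continuous cH)).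
pose M := `|H x0|; have M0 : 0 <= M by rewrite normr_ge0.
have Mle : - M <= M by lra.
have cst c : continuous (fun _ : R => c : R) by move=> x; exact: cvg_cst.
have cHc c : continuous (fun x => H x - c) by exact: fctB_continuous.
pose phi c := int01 (fun x => `|H x - c|).
have cphi : continuous phi.
  apply: (@lipschitz_continuous 1) => // c d; rewrite mul1r /phi.
  rewrite -int01B; [|exact: fct_norm_continuous..].
  rewrite (le_trans (int01_norm_le _))//.
    by apply: fctB_continuous; exact: fct_norm_continuous.
  rewrite -[leRHS]int01_cst; apply: le_int01 => // [|x _].
    by apply: fct_norm_continuous; apply: fctB_continuous; exact: fct_norm_continuous.
  rewrite (le_trans (ler_dist_dist _ _))// opprB addrC addrA subrK distrC//.
(* [c] must not depend on [e], whereas the level [d] found below does; minimality of [phi c] makes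
   the passage from [d] to [c] free. *)
have [c _ cmin] := EVT_min Mle (continuous_subspaceT cphi).
exists c => e e0.
pose s d x := clip ((H x - d) / e).
have cclip : continuous clip.
  by apply: (@lipschitz_continuous 1) => // y z; rewrite mul1r clip_lip.
have cs d : continuous (s d).
  move=> x; apply: (@continuous_comp _ _ _ (fun x => (H x - d) / e) clip).
    by apply: (@fctM_continuous _ (fun x => H x - d) (fun=> e^-1)).
  exact: cclip.
have cpsi : continuous (fun d => int01 (s d)).
  apply: (@lipschitz_continuous e^-1); first by rewrite invr_gt0.
  move=> d d'; rewrite -int01B// (le_trans (int01_norm_le _))//.
    exact: fctB_continuous.
  rewrite -[leRHS]int01_cst; apply: le_int01 => // [|x _].
    by apply: fct_norm_continuous; exact: fctB_continuous.
  rewrite (le_trans (clip_lip _ _))// -mulrBl normrM [leRHS]mulrC.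
  rewrite [`|e^-1|]ger0_norm ?invr_ge0 ?(ltW e0)// ler_wpM2r ?invr_ge0 ?(ltW e0)//.
  by rewrite opprB addrC addrA subrK distrC.
have clip_ge0 y : 0 <= y -> 0 <= clip y by case: (clipP y) => -[hy ->]; lra.
have clip_le0 y : y <= 0 -> clip y <= 0 by case: (clipP y) => -[hy ->]; lra.
have HMx x : x \in `[0, 1] -> - M <= H x <= M by move=> /HM; rewrite ler_norml.
(* Since [|H| <= M], the smoothed sign of [H - d] is nonnegative for [d = - M] and nonpositive for
   [d = M]; in between, its mean vanishes, as a periodic primitive requires. *)
have [|d dM sd] := @IVT R _ (- M) M 0 Mle (continuous_subspaceT cpsi).
  have h1 : 0 <= int01 (s (- M)).
    apply: Rintegral_ge0 => x /= x01; apply: clip_ge0; rewrite opprK.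
    by rewrite divr_ge0 ?(ltW e0)//; have := HMx x x01; lra.
  have h2 : int01 (s M) <= 0.
    rewrite -[leRHS](int01_cst 0); apply: le_int01 => // x x01; apply: clip_le0.
    by rewrite pmulr_lle0 ?invr_gt0//; have := HMx x x01; lra.
  by rewrite ge_min le_max h1 h2 orbT.
exists (fun x => \int[leb]_(y in `[0, x]) s d y).
  by apply: primitive_lip1 => // x; exact: clip_norm.
rewrite charge_integral_primitive//; last by move=> x; exact: clip_norm.
rewrite /abse normrN lee_fin (le_trans _ (ler_norm _))//.
apply: (@le_trans _ _ (phi d - e)); first by rewrite lerD2r; exact: cmin.
rewrite /phi -[X in _ - X <= _](@int01_cst R e).
rewrite -int01B; [|exact: fct_norm_continuous|exact: cst].
(* [s d] has mean 0, so a constant may be subtracted from [H]. *)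
have -> : int01 (fun x => s d x * H x) = int01 (fun x => s d x * (H x - d)).
  have -> : int01 (fun x => s d x * (H x - d)) =
      int01 (fun x => s d x * H x - d * s d x).
    by apply: eq_Rintegral => x _; ring.
  rewrite int01B; [|exact: fctM_continuous|exact: fctZ_continuous].
  by rewrite int01Z// sd mulr0 subr0.
apply: le_int01.
- by apply: fctB_continuous => //; exact: fct_norm_continuous.
- exact: fctM_continuous.
move=> x _; have := clip_mul ((H x - d) / e); rewrite -/(s d x).
rewrite normrM (ger0_norm (x := e^-1)) ?invr_ge0 ?(ltW e0)// => h.
have := ler_wpM2r (ltW e0) h.
by rewrite mulrBl mul1r mulrA !divfK ?gt_eqF.
Qed.

End wasserstein_lower_bound.

(** * From Wasserstein to L1 approximation *)

Section primitives.
Variables (R : realType) (n : nat).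
Implicit Types (p q T : R -> R).
Local Notation leb := (@lebesgue_measure R).

(** Removing the mean 1 of [p] is what allows an antiderivative to be periodic; it matches the [- t]
    in [G]. *)
Definition primitive p T := is_trigpoly n T /\
  forall x : R, is_derive x 1 T (p x - 1).

Lemma is_trigpoly_cst (c : R) : is_trigpoly n (fun=> c).
Proof.
have -> : (fun=> c) = trig (fun j : 'I_n.*2.+1 => (j == mid n)%:R * c) (fun=> 0).
  apply/funext => x; rewrite /trig (bigD1 (mid n))//= big1 => [|j /negbTE ->].
    have /eqP -> : freq R (mid n) == 0 by rewrite freq_eq0.
    by rewrite eqxx !mul0r cos0 mul1r mulr1 subr0 addr0.
  by rewrite !mul0r subrr.
exact: trig_is_trigpoly.
Qed.

Lemma primitive_exists p : is_trigpoly n p -> int01 p = 1 -> exists T, primitive p T.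
Proof.
move=> /is_trigpoly_trig[a [b pE]]; rewrite pE int01_trig => a1.
exists (trig (fun j => b j / freq R j) (fun j => - a j / freq R j)).
split; first exact: trig_is_trigpoly.
move=> x; rewrite (trig_antiderivative a b) a1 addrC addKr; exact: trig_derive.
Qed.

Lemma primitive_addc p T (c : R) : primitive p T -> primitive p (fun x => T x + c).
Proof.
move=> [tT dT]; split.
  have := is_trigpoly_lin 1 1 tT (is_trigpoly_cst c).
  by congr is_trigpoly; apply/funext => x; rewrite !mul1r.
move=> x; have := is_deriveD (dT x) (is_derive_cst c x (1 : R)).
by rewrite addr0.
Qed.

Lemma is_primitive T : is_trigpoly n T -> exists2 p, is_trigpoly n p & primitive p T.
Proof.
move=> tT; have [a [b TE]] := is_trigpoly_trig tT.
exists (fun x => 1 * trig (fun j => - freq R j * b j)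
  (fun j => freq R j * a j) x + 1 * 1).
  by apply: is_trigpoly_lin; [exact: trig_is_trigpoly|exact: is_trigpoly_cst].
by split=> // x; rewrite TE !mul1r addrK; exact: trig_derive.
Qed.

Lemma primitive_integral p T (t : R) : is_trigpoly n p -> primitive p T -> 0 <= t ->
  \int[leb]_(x in `[0, t]) p x = t + (T t - T 0).
Proof.
move=> tp [_ dT] t0.
have dTid (x : R) : is_derive x 1 (fun y : R => T y + y) (p x).
  have /is_derive_eq := is_deriveD (dT x) (is_derive_id x (1 : R)).
  by apply; rewrite subrK.
rewrite (Rintegral_FTC2 t0 (continuous_is_trigpoly tp) dTid); ring.
Qed.

End primitives.

Section wasserstein_L1.
Variables (R : realType) (n : nat).
Variable mu : {charge set (measurableTypeR R) -> \bar R}.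
Variable M : R -> R.
Hypotheses (cM : continuous M) (M1 : M 1 = 1).
Hypothesis ME : forall t, 0 <= t <= 1 -> mu `[0, t[%classic = (M t)%:E.
Local Notation leb := (@lebesgue_measure R).
Implicit Types (p : trigpoly R n) (T : R -> R).

Let G t := M t - t.

Lemma trigpoly_cdf p t : 0 <= t <= 1 ->
  trigpoly_charge p `[0, t[%classic = (\int[leb]_(x in `[0, t]) p x)%:E.
Proof.
move=> /andP[t0 t1].
have cp := continuous_is_trigpoly (trigpolyP p).
have ip : leb.-integrable `[0, t] (EFin \o p) by exact: continuous_integrable_itv.
have ip' : leb.-integrable `[0, t[ (EFin \o p).
  by apply: integrableS ip => //; exact: subset_itv_co_cc.
rewrite -Rintegral_itv_bndo_bndc// /Rintegral fineK; last exact: integrable_fin_num.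
apply: eq_integral => x; rewrite inE/= in_itv/= => /andP[x0 xt].
by rewrite patchE mem_set// /torus/= in_itv/= x0 (lt_le_trans xt).
Qed.

Lemma cadd_cdf p t : 0 <= t <= 1 ->
  cadd (trigpoly_charge p) (copp mu) `[0, t[%classic
  = (\int[leb]_(x in `[0, t]) p x - M t)%:E.
Proof. by move=> t01; rewrite /cadd/= /copp/= ME// trigpoly_cdf// EFinB. Qed.

Lemma primitive_cadd_cdf p T (H := fun t => T t - T 0 - G t) : primitive n p T ->
  [/\ continuous H, H 1 = 0 & forall t, 0 <= t <= 1 ->
    cadd (trigpoly_charge p) (copp mu) `[0, t[%classic = (H t)%:E].
Proof.
move=> pT; have [tT _] := pT; have cT := continuous_is_trigpoly tT; split.
- apply: fctB_continuous; first by apply: fctB_continuous => // x; exact: cvg_cst.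
  by apply: fctB_continuous => // x; exact: cvg_id.
- by rewrite /H /G M1 (is_trigpoly_period tT) !subrr.
- move=> t t01; rewrite cadd_cdf// (primitive_integral (trigpolyP p) pT).
    by congr _%:E; rewrite /H /G; ring.
  by case/andP: t01.
Qed.

Lemma W1_le_L1 p T : primitive n p T ->
  (W1 (trigpoly_charge p) mu <= (int01 (fun x => `|G x - T x|))%:E)%E.
Proof.
move=> pT; have [cH H1 HE] := primitive_cadd_cdf pT.
apply: ge_ereal_sup => _ [f lf <-].
(* With the constant [- T 0], the function [H - c] is exactly [T - G]. *)
rewrite (le_trans (charge_integral_le cH H1 HE (- T 0) lf))// lee_fin.
rewrite le_eqVlt; apply/orP; left; apply/eqP; apply: eq_Rintegral => x _.
by rewrite distrC; congr `|_|; ring.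
Qed.

Lemma charge_integral_cst (eta : {charge set (measurableTypeR R) -> \bar R}) (c : R) :
  charge_integral eta (fun=> c) = (c%:E * eta (torus R))%E.
Proof.
have mT : measurable (torus R : set (measurableTypeR R)) by exact: measurable_itv.
rewrite /charge_integral; set h := svalP _.
rewrite [in RHS](jordan_decomp h)// !integral_cst//.
rewrite /cadd/= cscaleN1 muleDr ?muleN// fin_num_adde_defl//.
by rewrite fin_numN fin_num_measure.
Qed.

Lemma L1_le_W1 p : (W1 (trigpoly_charge p) mu < +oo)%E ->
  exists2 T, primitive n p T &
    ((int01 (fun x => `|G x - T x|))%:E <= W1 (trigpoly_charge p) mu)%E.
Proof.
move=> Wfin.
have W_ge f : lip1 f ->
    (`|charge_integral (cadd (trigpoly_charge p) (copp mu)) f|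
      <= W1 (trigpoly_charge p) mu)%E.
  by move=> lf; apply: ereal_sup_ubound; exists f.
(* Constants are admissible test functions. If the mass were not 1, the constant
   [(w + 1) / (int01 p - 1)] would integrate to [w + 1], above the supremum [w]. *)
have Ip : int01 p = 1.
  apply: contrapT => /eqP; rewrite -subr_eq0 => Ip.
  pose w := fine (W1 (trigpoly_charge p) mu).
  have W0 : (0 <= W1 (trigpoly_charge p) mu)%E.
    by apply: le_trans (W_ge _ (lip1_cst 0)); exact: abse_ge0.
  have WE : W1 (trigpoly_charge p) mu = w%:E by rewrite fineK// ge0_fin_numE.
  have w0 : 0 <= w by rewrite fine_ge0.
  have etaT : cadd (trigpoly_charge p) (copp mu) (torus R) = (int01 p - M 1)%:E.
    by apply: cadd_cdf; rewrite ler01 lexx.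
  rewrite M1 in etaT; have := W_ge _ (lip1_cst ((w + 1) / (int01 p - 1))).
  rewrite charge_integral_cst [X in (_ * X)%E](_ : _ = (int01 p - 1)%:E)//.
  by rewrite -EFinM divfK// WE /abse lee_fin ger0_norm; lra.
have [T pT] := primitive_exists (trigpolyP p) Ip.
have [cH H1 HE] := primitive_cadd_cdf pT.
have [c cP] := charge_integral_ge cH H1 HE.
(* The free additive constant of the primitive absorbs both [T 0] and the level [c]. *)
exists (fun x => T x + (- T 0 - c)); first exact: primitive_addc.
apply/lee_addgt0Pr => e e0; have [f lf fP] := cP e e0.
rewrite -leeBlDr// -EFinB; apply: le_trans (W_ge f lf); apply: le_trans fP.
rewrite lee_fin lerD2r le_eqVlt; apply/orP; left; apply/eqP.
by apply: eq_Rintegral => x _; rewrite distrC; congr `|_|; ring.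
Qed.

End wasserstein_L1.

Theorem lemma2p9 (R : realType) (n : nat) (hn : (0 < n)%N)
    (mu : {charge set (measurableTypeR R) -> \bar R})
    (hmu : unit_mass_torus_charge mu)
    (hac : mu `<< (@lebesgue_measure R)) :
  exists! p : trigpoly R n, best_approx mu p.
Proof.
have [M cM ME] := dominated_cdf hac.
have M1 : M 1 = 1.
  by apply: EFin_inj; rewrite -ME ?ler01 ?lexx//; have [_ ->] := hmu.
have M0 : M 0 = 0.
  apply: EFin_inj; rewrite -ME ?lexx ?ler01// set_itv_ge ?bnd_simp ?ltxx//.
  exact: charge0.
pose G t := M t - t.
have cG : continuous G by apply: fctB_continuous => // x; exact: cvg_id.
have G01 : G 0 = G 1 by rewrite /G M0 M1 !subrr.
have [T [tT minT]] := L1_best_approx_exists n cG.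
have [p tp pT] := is_primitive tT.
have le_Phi := W1_le_L1 cM M1 ME.
exists (TrigPoly tp); split.
  move=> q; have [Wq|] := ltP (W1 (trigpoly_charge q) mu) +oo%E; last first.
    by rewrite leye_eq => /eqP ->; exact: leey.
  have [S [tS qS] SW] := L1_le_W1 cM M1 ME Wq.
  apply: le_trans SW; apply: (le_trans (le_Phi n (TrigPoly tp) T pT)).
  by rewrite lee_fin; exact: minT.
move=> q qbest.
(* The distance for [q] is finite, being at most the one for [p], so [q] has a primitive [S];
   comparison with the polynomial [r] built from any [U] makes [S] a best L1 approximation of
   [G]. *)
have [S qS SW] : exists2 S, primitive n q S &
    ((int01 (fun x => `|G x - S x|))%:E <= W1 (trigpoly_charge q) mu)%E.
  apply: (L1_le_W1 cM M1 ME); apply: le_lt_trans (qbest (TrigPoly tp)) _.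
  exact: le_lt_trans (le_Phi n (TrigPoly tp) T pT) (ltry _).
have minS U : is_trigpoly n U ->
    int01 (fun x => `|G x - S x|) <= int01 (fun x => `|G x - U x|).
  move=> tU; have [r tr rU] := is_primitive tU.
  rewrite -lee_fin; apply: (le_trans SW).
  apply: (le_trans (qbest (TrigPoly tr))); exact: (le_Phi n (TrigPoly tr) U rU).
have ST : T = S.
  apply: (@L1_best_approx_unique R n G cG G01) => //; exact: (proj1 qS).
have pq : p = q.
  apply/funext => x; have [_ /(_ x) d1] := pT; have [_ /(_ x) d2] := qS.
  have e1 := @derive_val _ _ _ _ _ _ _ d1; have e2 := @derive_val _ _ _ _ _ _ _ d2.
  by rewrite ST in e1; apply/(subIr 1); rewrite -e1 -e2.
case: q pq {qbest SW qS} => q tq /= pq; subst q.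
by congr TrigPoly; exact: Prop_irrelevance.
Qed.
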